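(* Let $A:S^1\to\mathbb{R}$ be Lipschitz. (1) If $\lambda_n\in(0,1)$, $\lambda_n\to 1$, $\mu_{\lambda_n}$ is a $\lambda_n$-maximizing probability for $A$ for each $n$, and $\mu_{\lambda_n}\to\nu$ weakly, then $\nu$ is a maximizing probability for $A$. (2) For a generic Lipschitz potential $A$ (in the Lipschitz topology) there exists $\epsilon>0$ such that for all $\lambda\in(1-\epsilon,1]$ the $\lambda$-maximizing probability for $A$ has support in the periodic orbit which defines (i.e. supports) the maximizing probability for $A$. (3) The same is true for potentials of class $C^1$: for a generic $C^1$ potential $A$ (in the $C^1$ topology) there exists $\epsilon>0$ such that for all $\lambda\in(1-\epsilon,1]$ the $\lambda$-maximizing probability for $A$ has support in the periodic orbit which supports the maximizing probability for $A$.
   Context: Let $d\ge 2$ be an integer and $T:S^1\to S^1$, $T(x)=dx \pmod 1$, $S^1=\mathbb{R}/\mathbb{Z}$. For $\lambda\in(0,1)$ and $A$ Lipschitz, the $\lambda$-calibrated subaction $b=b_\lambda$ is the unique continuous function $b:S^1\to\mathbb{R}$ with $b(x)=\max_{T(y)=x}\{\lambda b(y)+A(y)\}$ for all $x$. A $\lambda$-maximizing probability for $A$ is a $T$-invariant Borel probability maximizing $\mu\mapsto\int (A-b\circ T+\lambda b)\,d\mu$ among $T$-invariant Borel probabilities. A maximizing probability for $A$ is a $T$-invariant probability $\rho$ with $\int A\,d\rho=\sup\{\int A\,d\mu:\mu \ T\text{-invariant}\}$. For $\lambda=1$, ''$\lambda$-maximizing probability'' means maximizing probability for $A$. ''Generic''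 means: for all potentials in a residual set (one containing a countable intersection of open dense sets) of the space of potentials with the indicated topology; for a generic Lipschitz potential the maximizing probability is unique and supported in a single periodic orbit of $T$. *)

(* Defs.v *)
From HB Require Import structures.
From mathcomp Require Import all_boot all_order all_algebra.
From mathcomp Require Import all_classical all_reals all_analysis.

Set Implicit Arguments.
Unset Strict Implicit.
Unset Printing Implicit Defensive.

Import Order.TTheory GRing.Theory Num.Theory.
Import numFieldNormedType.Exports.

Local Open Scope classical_set_scope.
Local Open Scope ring_scope.

(* R / Z.  [Num.int_num_subdef] is the predicate underlying [Num.int], the    *)
(* one that carries the subgroup structure.                                   *)
Definition circle (R : realType) : Type :=
  {ideal_quot ((@Num.int_num_subdef R : {pred R}) : zmodClosed R)}.

HB.instance Definition _ (R : realType) :=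
  ZmodQuotient.on (circle R).

Definition to_circle (R : realType) (r : R) : circle R := (\pi r)%qT.

Section circle_metric.
Context {R : realType}.
Implicit Types (x y z : circle R) (r s : R).

Lemma to_circleB : {morph @to_circle R : r s / r - s >-> r - s}.
Proof. by move=> r s; rewrite /to_circle raddfB. Qed.

Lemma to_circle0 : @to_circle R 0 = 0.
Proof. exact: raddf0. Qed.

Lemma to_circle_surj x : exists r, to_circle r = x.
Proof. by exists (repr x); rewrite /to_circle reprK. Qed.

Lemma to_circle_eq r s : (to_circle r == to_circle s) = (r - s \is a Num.int).
Proof. by rewrite -Quotient.idealrBE. Qed.

(* Quotient metric: least absolute value of a real representing x - y.        *)
Definition circle_dist x y : R :=
  inf [set `|r| | r in @to_circle R @^-1` [set x - y]].

Let fiber_norm x : set R := [set `|r| | r in @to_circle R @^-1` [set x]].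

Let fiber_norm_has_inf x : has_inf (fiber_norm x).
Proof.
split; last by exists 0 => _ [r _ <-].
by have [r rx] := to_circle_surj x; exists `|r|, r.
Qed.

Let circle_distxx x : circle_dist x x = 0.
Proof.
apply/eqP; rewrite eq_le; apply/andP; split.
  apply: ge_inf; first exact: (fiber_norm_has_inf (x - x)).2.
  by exists 0; rewrite ?normr0//= subrr to_circle0.
by apply: lb_le_inf; [exact: (fiber_norm_has_inf _).1|move=> _ [r _ <-]].
Qed.

Let circle_dist_pos x y : circle_dist x y = 0 -> x = y.
Proof.
move=> d0; apply/eqP; rewrite -subr_eq0; apply/eqP.
have small (e : R) : 0 < e -> exists2 r, to_circle r = x - y & `|r| < e.
  move=> e0; have [_ [r rxy <-]] := inf_adherent e0 (fiber_norm_has_inf (x - y)).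
  by rewrite -/(circle_dist x y) d0 add0r => re; exists r.
have half0 : 0 < 2^-1 :> R by rewrite invr_gt0.
have [r rxy r1] := small _ half0.
have [r00|r0] := eqVneq r 0; first by rewrite -rxy r00 to_circle0.
have m0 : 0 < Num.min `|r| 2^-1 by rewrite lt_min normr_gt0 r0.
have [s sxy] := small _ m0.
rewrite lt_min => /andP[sr s1].
have : r - s \is a Num.int by rewrite -to_circle_eq rxy sxy.
move=> rs; have := norm_intr_ge1 rs.
rewrite subr_eq0 (_ : (r != s) = true); last first.
  by apply/eqP => rs'; rewrite rs' ltxx in sr.
move=> /(_ isT); rewrite leNgt (le_lt_trans (ler_normB _ _))//.
by rewrite [ltRHS](splitr 1) ltrD// div1r.
Qed.

Let circle_distC x y : circle_dist x y = circle_dist y x.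
Proof.
rewrite /circle_dist; congr inf; apply/seteqP; split=> _ [r /= rxy <-].
  by exists (- r); rewrite ?normrN//= -sub0r to_circleB to_circle0 rxy sub0r opprB.
by exists (- r); rewrite ?normrN//= -sub0r to_circleB to_circle0 rxy sub0r opprB.
Qed.

Let circle_dist_triangle y x z :
  circle_dist x z <= circle_dist x y + circle_dist y z.
Proof.
apply/ler_addgt0Pr => e e0.
have e20 : 0 < e / 2 by rewrite divr_gt0.
have [_ [r /= rxy <-] re] := inf_adherent e20 (fiber_norm_has_inf (x - y)).
have [_ [s /= syz <-] se] := inf_adherent e20 (fiber_norm_has_inf (y - z)).
apply: (@le_trans _ _ `|r + s|).
  apply: ge_inf; first exact: (fiber_norm_has_inf (x - z)).2.
  exists (r + s) => //=; rewrite -[s]opprK to_circleB -sub0r to_circleB.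
  by rewrite to_circle0 rxy syz sub0r opprK addrA subrK.
rewrite (le_trans (ler_normD _ _))// (splitr e) addrACA.
by apply: lerD; apply: ltW.
Qed.

HB.instance Definition _ := isMetric.Build R (circle R)
  circle_distxx circle_dist_pos circle_distC circle_dist_triangle.

HB.instance Definition _ := isPointed.Build (circle R) 0.

(* Borel sigma-algebra *)
HB.instance Definition _ := @isMeasurable.Build
  (sigma_display (@open (circle R))) (circle R) <<s @open (circle R) >>
  (@sigma_algebra0 _ setT _) (@sigma_algebraC _ _)
  (@sigma_algebra_bigcup _ setT _).

End circle_metric.

Section sup_norm.
Context {R : realType} {T : Type}.
Implicit Types (D : set T) (f g : T -> R).

Definition bounded_on D f := exists M : R, forall t, D t -> `|f t| <= M.

Definition sup_norm D f : R := sup [set `|f t| | t in D].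

Lemma sup_norm_ub D f t : bounded_on D f -> D t -> `|f t| <= sup_norm D f.
Proof.
move=> [M fM] Dt; apply: ub_le_sup; last by exists t.
by exists M => _ [u Du <-]; exact: fM.
Qed.

Lemma sup_norm_le D f (M : R) : 0 <= M ->
  (forall t, D t -> `|f t| <= M) -> sup_norm D f <= M.
Proof.
move=> M0 fM; have [->|/set0P[t Dt]] := eqVneq D set0.
  by rewrite /sup_norm image_set0 sup0.
by apply: sup_le_ub; [exists `|f t|, t|move=> _ [u Du <-]; exact: fM].
Qed.

Lemma sup_norm_ge0 D f : bounded_on D f -> 0 <= sup_norm D f.
Proof.
move=> bf; have [->|/set0P[t Dt]] := eqVneq D set0.
  by rewrite /sup_norm image_set0 sup0.
exact: le_trans (normr_ge0 _) (sup_norm_ub bf Dt).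
Qed.

Lemma sup_norm0 D : sup_norm D (fun=> 0) = 0.
Proof.
apply/eqP; rewrite eq_le; apply/andP; split.
  by apply: sup_norm_le => // t _; rewrite normr0.
by apply: sup_norm_ge0; exists 0 => t _; rewrite normr0.
Qed.

Lemma sup_normN D f : sup_norm D (\- f) = sup_norm D f.
Proof.
by rewrite /sup_norm; congr sup; apply: eq_imagel => t _; rewrite normrN.
Qed.

Lemma bounded_onD D f g :
  bounded_on D f -> bounded_on D g -> bounded_on D (f \+ g).
Proof.
move=> [M fM] [N gN]; exists (M + N) => t Dt.
by rewrite (le_trans (ler_normD _ _))// lerD ?fM ?gN.
Qed.

Lemma bounded_onN D f : bounded_on D f -> bounded_on D (\- f).
Proof. by move=> [M fM]; exists M => t Dt; rewrite normrN fM. Qed.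

Lemma sup_normD D f g : bounded_on D f -> bounded_on D g ->
  sup_norm D (f \+ g) <= sup_norm D f + sup_norm D g.
Proof.
move=> bf bg; apply: sup_norm_le => [|t Dt].
  by rewrite addr_ge0// sup_norm_ge0.
by rewrite (le_trans (ler_normD _ _))// lerD// sup_norm_ub.
Qed.

End sup_norm.

Section lipschitz_potentials.
Context {R : realType}.
Implicit Types f g : circle R -> R.

Definition circle_lipschitz f :=
  exists K : R, forall x y, `|f x - f y| <= K * mdist x y.

Definition diff_quotient f (p : circle R * circle R) : R :=
  (f p.1 - f p.2) / mdist p.1 p.2.

Definition off_diagonal : set (circle R * circle R) := [set p | p.1 != p.2].

(* The second term is the best Lipschitz constant of f.                       *)
Definition lip_norm f : R :=
  sup_norm setT f + sup_norm off_diagonal (diff_quotient f).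

Lemma circle_dist_le1 (x y : circle R) : mdist x y <= 1.
Proof.
have [r rxy] := to_circle_surj (x - y).
pose s := r - (Num.floor r)%:~R.
have /andP[s0 s1] : 0 <= s < 1.
  have := floor_itv r; rewrite intrD => /andP[rl ru].
  by rewrite subr_ge0 rl ltrBlDl.
apply: (@le_trans _ _ `|s|); last by rewrite ger0_norm// ltW.
apply: ge_inf; first by exists 0 => _ [? _ <-].
exists s => //=; apply/eqP; rewrite -rxy to_circle_eq addrAC subrr sub0r.
by rewrite rpredN intr_int.
Qed.

Lemma circle_lipschitz_bounded f : circle_lipschitz f -> bounded_on setT f.
Proof.
move=> [K fK]; exists (`|f 0| + `|K|) => x _.
rewrite -[f x](subrK (f 0)) addrC (le_trans (ler_normD _ _))// lerD//.
rewrite (le_trans (fK _ _))// -[leRHS]mulr1 (le_trans (ler_norm _))// normrM.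
by rewrite ler_wpM2l// ger0_norm ?mdist_ge0 ?circle_dist_le1.
Qed.

Lemma diff_quotient_bounded f :
  circle_lipschitz f -> bounded_on off_diagonal (diff_quotient f).
Proof.
move=> [K fK]; exists K => -[x y] /= xy; rewrite /diff_quotient/= normrM.
have d0 : 0 < mdist x y by rewrite mdist_gt0.
by rewrite normfV (gtr0_norm d0) ler_pdivrMr.
Qed.

Lemma circle_lipschitzB f g :
  circle_lipschitz f -> circle_lipschitz g -> circle_lipschitz (f \- g).
Proof.
move=> [K fK] [L gL]; exists (K + L) => x y /=.
have -> : f x - g x - (f y - g y) = (f x - f y) - (g x - g y).
  by rewrite !opprB addrACA [RHS]addrACA; congr (_ + _); rewrite addrC.
by rewrite (le_trans (ler_normB _ _))// mulrDl lerD.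
Qed.

Record lip_potential := LipPotential {
  lip_fun :> circle R -> R ;
  lip_funP : circle_lipschitz lip_fun }.

HB.instance Definition _ := gen_eqMixin lip_potential.
HB.instance Definition _ := gen_choiceMixin lip_potential.

Definition lip_dist (A B : lip_potential) : R := lip_norm (A \- B).

Lemma lip_potential_eq (A B : lip_potential) : A =1 B -> A = B.
Proof.
case: A B => [f fP] [g gP] /= /funext fg; rewrite fg in fP *.
by congr LipPotential; exact: Prop_irrelevance.
Qed.

Let lip_distxx A : lip_dist A A = 0.
Proof.
rewrite /lip_dist /lip_norm.
rewrite (_ : A \- A = fun=> 0); last by apply/funext => x /=; rewrite subrr.
rewrite (_ : diff_quotient _ = fun=> 0) ?sup_norm0 ?addr0//.
by apply/funext => x; rewrite /diff_quotient subrr mul0r.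
Qed.

Let lip_dist_pos A B : lip_dist A B = 0 -> A = B.
Proof.
have AB := circle_lipschitzB (lip_funP A) (lip_funP B).
have b1 := circle_lipschitz_bounded AB.
move/eqP; rewrite paddr_eq0 ?sup_norm_ge0//; last exact: diff_quotient_bounded.
move=> /andP[/eqP s0 _]; apply: lip_potential_eq => x.
apply/eqP; rewrite -subr_eq0 -normr_le0 -s0.
exact: (sup_norm_ub b1).
Qed.

Let lip_distC A B : lip_dist A B = lip_dist B A.
Proof.
rewrite /lip_dist /lip_norm.
have -> : A \- B = \- (B \- A) by apply/funext => x /=; rewrite opprB.
rewrite sup_normN; congr (_ + _).
rewrite -[RHS]sup_normN; congr sup_norm; apply/funext => p.
by rewrite /diff_quotient/= -opprD mulNr.
Qed.

Let lip_dist_triangle B A C : lip_dist A C <= lip_dist A B + lip_dist B C.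
Proof.
have AB := circle_lipschitzB (lip_funP A) (lip_funP B).
have BC := circle_lipschitzB (lip_funP B) (lip_funP C).
rewrite /lip_dist /lip_norm addrACA.
have -> : A \- C = (A \- B) \+ (B \- C).
  by apply/funext => x /=; rewrite addrA subrK.
apply: lerD.
  by apply: sup_normD; exact: circle_lipschitz_bounded.
rewrite (_ : diff_quotient _ =
    diff_quotient (A \- B) \+ diff_quotient (B \- C)).
  by apply: sup_normD; exact: diff_quotient_bounded.
by apply/funext => p; rewrite /diff_quotient/= -mulrDl opprD addrACA.
Qed.

HB.instance Definition _ := isMetric.Build R lip_potential
  lip_distxx lip_dist_pos lip_distC lip_dist_triangle.

End lipschitz_potentials.
Arguments lip_potential : clear implicits.

Section c1_potentials.
Context {R : realType}.
Implicit Types f g : circle R -> R.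

(* Differentiation on the circle is that of the 1-periodic lift to R.         *)
Definition circle_C1 f :=
  (forall r : R, derivable (f \o @to_circle R) r 1) /\
  continuous (derive1 (f \o @to_circle R)).

Definition C1_norm f : R :=
  sup_norm setT f + sup_norm setT (derive1 (f \o @to_circle R)).

Lemma to_circleDz (r : R) (n : int) : to_circle (r + n%:~R) = to_circle r.
Proof.
by apply/eqP; rewrite to_circle_eq addrAC subrr add0r intr_int.
Qed.

Lemma to_circle_frac (r : R) :
  exists2 s, 0 <= s <= 1 & exists n : int, r = s + n%:~R.
Proof.
exists (r - (Num.floor r)%:~R); last by exists (Num.floor r); rewrite subrK.
have := floor_itv r; rewrite intrD => /andP[rl ru].
by rewrite subr_ge0 rl/= lerBlDl ltW.
Qed.

Lemma continuous_periodic_bounded (h : R -> R) :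
  continuous h -> (forall r (n : int), h (r + n%:~R) = h r) -> bounded_on setT h.
Proof.
move=> ch ph.
have cn : {within `[0, 1], continuous (fun r => `|h r|)}.
  apply: continuous_subspaceT => r.
  by apply: continuous_comp; [exact: ch|exact: norm_continuous].
have [c _ hc] := EVT_max ler01 cn.
exists `|h c| => r _; have [s s01 [n ->]] := to_circle_frac r.
by rewrite ph; apply: hc; rewrite in_itv.
Qed.

Lemma circle_C1_bounded f : circle_C1 f -> bounded_on setT f.
Proof.
move=> [df _].
have [|r n|M fM] := @continuous_periodic_bounded (f \o @to_circle R).
- move=> r; apply: differentiable_continuous; apply/derivable1_diffP.
  exact: df.
- by rewrite /= to_circleDz.
exists M => x _; have [r <-] := to_circle_surj x.
exact: fM.
Qed.

Lemma circle_C1_derive_bounded f :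
  circle_C1 f -> bounded_on setT (derive1 (f \o @to_circle R)).
Proof.
move=> [df cf]; apply: continuous_periodic_bounded => // r n.
rewrite /derive1 /= to_circleDz; apply: (f_equal (fun k : R -> R => lim (k h @[h --> 0^']))).
by apply/funext => h; rewrite addrA to_circleDz.
Qed.

Record C1_potential := C1Potential {
  C1_fun :> circle R -> R ;
  C1_funP : circle_C1 C1_fun }.

HB.instance Definition _ := gen_eqMixin C1_potential.
HB.instance Definition _ := gen_choiceMixin C1_potential.

Definition C1_dist (A B : C1_potential) : R := C1_norm (A \- B).

Lemma C1_potential_eq (A B : C1_potential) : A =1 B -> A = B.
Proof.
case: A B => [f fP] [g gP] /= /funext fg; rewrite fg in fP *.
by congr C1Potential; exact: Prop_irrelevance.
Qed.

Lemma C1_deriveB f g : circle_C1 f -> circle_C1 g ->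
  derive1 ((f \- g) \o @to_circle R) =
  derive1 (f \o @to_circle R) \- derive1 (g \o @to_circle R).
Proof.
move=> [df _] [dg _]; apply/funext => r.
by rewrite /= !derive1E; apply: deriveB.
Qed.

Lemma circle_C1B f g : circle_C1 f -> circle_C1 g -> circle_C1 (f \- g).
Proof.
move=> fP gP; split.
  by move=> r; apply: derivableB; [exact: fP.1|exact: gP.1].
by rewrite C1_deriveB// => r; apply: continuousB; [exact: fP.2|exact: gP.2].
Qed.

Let C1_distxx A : C1_dist A A = 0.
Proof.
rewrite /C1_dist /C1_norm C1_deriveB; [|exact: C1_funP..].
rewrite (_ : A \- A = fun=> 0); last by apply/funext => x /=; rewrite subrr.
rewrite (_ : _ \- _ = fun=> 0); last by apply/funext => x /=; rewrite subrr.
by rewrite !sup_norm0 addr0.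
Qed.

Let C1_dist_pos A B : C1_dist A B = 0 -> A = B.
Proof.
have AB := circle_C1B (C1_funP A) (C1_funP B).
have b1 := circle_C1_bounded AB.
move/eqP; rewrite paddr_eq0 ?sup_norm_ge0//; last first.
  exact: circle_C1_derive_bounded.
move=> /andP[/eqP s0 _]; apply: C1_potential_eq => x.
apply/eqP; rewrite -subr_eq0 -normr_le0 -s0.
exact: (sup_norm_ub b1).
Qed.

Let C1_distC A B : C1_dist A B = C1_dist B A.
Proof.
rewrite /C1_dist /C1_norm !C1_deriveB; try exact: C1_funP.
by congr (_ + _); rewrite -sup_normN; congr sup_norm; apply/funext => x /=;
  rewrite opprB.
Qed.

Let C1_dist_triangle B A C : C1_dist A C <= C1_dist A B + C1_dist B C.
Proof.
have AB := circle_C1B (C1_funP A) (C1_funP B).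
have BC := circle_C1B (C1_funP B) (C1_funP C).
rewrite /C1_dist /C1_norm addrACA; apply: lerD.
  have -> : A \- C = (A \- B) \+ (B \- C).
    by apply/funext => x /=; rewrite addrA subrK.
  by apply: sup_normD; exact: circle_C1_bounded.
have -> : derive1 ((A \- C) \o @to_circle R) =
    derive1 ((A \- B) \o @to_circle R) \+ derive1 ((B \- C) \o @to_circle R).
  rewrite !C1_deriveB; try exact: C1_funP.
  by apply/funext => x /=; rewrite addrA subrK.
by apply: sup_normD; exact: circle_C1_derive_bounded.
Qed.

HB.instance Definition _ := isMetric.Build R C1_potential
  C1_distxx C1_dist_pos C1_distC C1_dist_triangle.

End c1_potentials.
Arguments C1_potential : clear implicits.

Section dynamics.
Context {R : realType}.
Variable d : nat.
Implicit Types (A b f : circle R -> R) (mu nu rho : probability (circle R) R).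

Definition expanding_map (x : circle R) : circle R := x *+ d.

Definition invariant_probability : set (probability (circle R) R) :=
  [set mu | forall B, measurable B -> mu (expanding_map @^-1` B) = mu B].

Definition maximizing f : set (probability (circle R) R) :=
  [set rho | invariant_probability rho /\
    (\int[rho]_x (f x)%:E =
     ereal_sup [set \int[mu]_x (f x)%:E | mu in invariant_probability])%E].

(* b x = max of S, with S indexed by the preimages of x                       *)
Definition calibrated_subaction (lam : R) A b :=
  continuous b /\
  forall x,
    let S := [set lam * b y + A y | y in expanding_map @^-1` [set x]] in
    S (b x) /\ ubound S (b x).

(* For 0 < lam < 1 there is exactly one calibrated subaction b, so the        *)
(* existential quantifier below merely names it.                              *)
Definition lambda_maximizing (lam : R) A : set (probability (circle R) R) :=
  if lam == 1 then maximizing A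
  else [set mu | exists2 b, calibrated_subaction lam A b &
    maximizing (fun x => A x - b (expanding_map x) + lam * b x) mu].

(* A [probability] is a function on all sets, constrained only on measurable  *)
(* ones, hence uniqueness up to equality on measurable sets.                  *)
Definition unique_probability (P : set (probability (circle R) R)) mu :=
  P mu /\ forall nu, P nu -> forall B, measurable B -> nu B = mu B.

Definition weakly_converges (mu_ : (probability (circle R) R)^nat) nu :=
  forall f, continuous f ->
    (\int[mu_ n]_x (f x)%:E)%E @[n --> \oo] --> (\int[nu]_x (f x)%:E)%E.

Definition msupport mu : set (circle R) :=
  [set x | forall U, open_nbhs x U -> (0 < mu U)%E].

Definition periodic_orbit (O : set (circle R)) :=
  exists x n, [/\ (0 < n)%N, iter n expanding_map x = x &
    O = [set iter k expanding_map x | k in [set: nat]]].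

Definition selects_periodic_orbit A :=
  exists O : set (circle R), [/\ periodic_orbit O,
    exists2 rho, unique_probability (maximizing A) rho & msupport rho = O &
    exists2 eps : R, 0 < eps & forall lam, 1 - eps < lam <= 1 ->
      exists2 mu, unique_probability (lambda_maximizing lam A) mu &
        msupport mu `<=` O].

End dynamics.

Definition generic (E : topologicalType) (P : set E) :=
  exists U : (set E)^nat,
    (forall n, open (U n) /\ dense (U n)) /\ \bigcap_n U n `<=` P.

(* Main.v *)
Require Import Defs.
From HB Require Import structures.
From mathcomp Require Import all_boot all_order all_algebra.
From mathcomp Require Import all_classical all_reals all_analysis.
From mathcomp Require Import measurable_realfun.
From mathcomp Require Import ring lra zify.
Import Order.TTheory GRing.Theory Num.Theory.
Import numFieldNormedType.Exports.
Local Open Scope classical_set_scope.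
Local Open Scope ring_scope.
Set Implicit Arguments.
Unset Strict Implicit.
Unset Printing Implicit Defensive.

(* For [lam < 1] close to 1 the calibrated subaction [b] turns [A] into
   [(1 - lam) * b - phi] up to a coboundary, where
   [phi = b \o T - lam * b - A >= 0] vanishes along a whole forward orbit and
   [(1 - lam) * b] is, up to a constant, a Lipschitz function of small norm.
   Counting words along the zero set of [phi] (Bressaud-Quas, Quas-Siefken) gives
   periodic orbits whose Birkhoff sum of [phi] is smaller than any given inverse
   power of the period; halving such an orbit wherever two of its points are too close
   (Huang-Lian-Ma-Xu-Zhang) produces a periodic orbit whose points are separated
   by much more than its Birkhoff sum of [phi].  Subtracting a small multiple of
   the distance to that orbit makes its measure the unique maximizing one, and
   this persists under perturbations that are small in the sup norm with a
   bounded Lipschitz constant.  The latter covers both the neighbouring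
   potentials and the term [(1 - lam) * b] in the definition of lambda-maximizing
   measures. *)

(** * Geometry of the circle and of the expanding map *)

(** Halving dictates the strength of the counting step. An orbit of period $N$ is halved about
    $\log_2 N$ times, so its Birkhoff sum may grow by $(1+KL)^{\log_2 N}$, a power of $N$ whose
    exponent depends on the wanted ratio $L$ of separation to Birkhoff sum; hence the initial sum
    must beat every power of the period. Discounting keeps all constants uniform: a Lipschitz
    constant of $A$ is one for every $b_\lambda$. Although $b_\lambda$ may be of order
    $1/(1-\lambda)$, the function $(1-\lambda)(b_\lambda-b_\lambda(0))$ tends to 0 in the Lipschitz
    norm. The distance to an orbit is not $C^1$, and smoothing it is accurate only in the sup norm.
    This is why locking must tolerate perturbations whose Lipschitz constant is bounded but not
    small. *)

Section circle_geometry.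
Context {R : realType}.
Implicit Types (x y : circle R) (f g : circle R -> R) (K L s t : R).

Lemma to_circleD : {morph @to_circle R : s t / s + t}.
Proof. by move=> s t; rewrite /to_circle raddfD. Qed.

Lemma to_circleMn t n : to_circle (t *+ n) = to_circle t *+ n.
Proof. by rewrite /to_circle raddfMn. Qed.

Lemma mdist_shift_le x t : mdist x (x + to_circle t) <= `|t|.
Proof.
apply: ge_inf; first by exists 0 => _ [? _ <-].
exists (- t); rewrite ?normrN//=.
by rewrite -[- t]sub0r to_circleB to_circle0 opprD addrA subrr.
Qed.

Lemma mdist_shift x t : `|t| <= 2^-1 -> mdist x (x + to_circle t) = `|t|.
Proof.
move=> t2; apply/eqP; rewrite eq_le mdist_shift_le/=.
apply: lb_le_inf.
  by exists `|- t|, (- t) => //=; rewrite -[- t]sub0r to_circleB to_circle0 opprD addrA subrr.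
move=> _ [r /= rt <-].
have : r - - t \is a Num.int.
  by rewrite -to_circle_eq rt -[- t]sub0r to_circleB to_circle0 opprD addrA subrr.
rewrite opprK => rtZ; have [rt0|rt0] := eqVneq (r + t) 0.
  by rewrite -normrN (_ : - t = r)//; apply/eqP; rewrite eq_sym -addr_eq0 rt0.
have := norm_intr_ge1 rtZ rt0; have := ler_normD r t; lra.
Qed.

Lemma mdist_lift x y :
  exists2 t, y = x + to_circle t & `|t| = mdist x y.
Proof.
have [r rxy] := to_circle_surj (y - x).
pose t := r - (Num.floor (r + 2^-1))%:~R.
have t2 : `|t| <= 2^-1.
  have := floor_itv (r + 2^-1); rewrite intrD => /andP[rl ru].
  by rewrite ler_norml /t; apply/andP; split; lra.
have ytx : y = x + to_circle t.
  have -> : to_circle t = to_circle r.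
    by apply/eqP; rewrite to_circle_eq /t addrAC subrr sub0r rpredN intr_int.
  by rewrite rxy addrC subrK.
by exists t => //; rewrite ytx mdist_shift.
Qed.

Definition lipK K f := forall x y, `|f x - f y| <= K * mdist x y.

Lemma lipK_ge0 K f : lipK K f -> 0 <= K.
Proof.
move=> /(_ 0 (0 + to_circle 2^-1)) h.
have h2 : `|2^-1 : R| = 2^-1 by rewrite ger0_norm// invr_ge0.
have := le_trans (normr_ge0 _) h; rewrite mdist_shift h2//.
by rewrite pmulr_lge0// invr_gt0.
Qed.

Lemma lipK_le K L f : K <= L -> lipK K f -> lipK L f.
Proof.
by move=> KL fK x y; rewrite (le_trans (fK x y))// ler_wpM2r// mdist_ge0.
Qed.

Lemma lipKD K L f g : lipK K f -> lipK L g -> lipK (K + L) (f \+ g).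
Proof.
move=> fK gL x y; rewrite mulrDl /= opprD addrACA.
by rewrite (le_trans (ler_normD _ _))// lerD.
Qed.

Lemma lipKZ K c f : lipK K f -> lipK (`|c| * K) (fun x => c * f x).
Proof.
by move=> fK x y; rewrite -mulrBr normrM -mulrA ler_wpM2l.
Qed.

Lemma lipKN K f : lipK K f -> lipK K (\- f).
Proof. by move=> fK x y; rewrite /= -opprD normrN. Qed.

Lemma lipKB K L f g : lipK K f -> lipK L g -> lipK (K + L) (f \- g).
Proof. by move=> fK gL; apply: lipKD => //; exact: lipKN. Qed.

Lemma lipK_cst c : lipK 0 (fun=> c).
Proof. by move=> x y; rewrite subrr normr0 mul0r. Qed.

Lemma lipK_ub K f x y : lipK K f -> `|f x - f y| <= K.
Proof.
move=> fK; rewrite (le_trans (fK x y))// -[leRHS]mulr1.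
by rewrite ler_wpM2l ?circle_dist_le1// (lipK_ge0 fK).
Qed.

Lemma lipK_continuous K f : lipK K f -> continuous f.
Proof.
move=> fK x; apply/(@cvgrPdist_lt _ _ _ _ (nbhs_filter x)) => e e0.
have K0 := lipK_ge0 fK.
have K1 : 0 < K + 1 by rewrite ltr_wpDl.
apply/nbhs_ballP; exists (e / (K + 1)); first by rewrite /= divr_gt0.
move=> y; rewrite ballEmdist /= ltr_pdivlMr// => xy.
rewrite /= (le_lt_trans (fK x y))// (le_lt_trans _ xy)// mulrC.
by rewrite ler_wpM2l ?mdist_ge0// lerDl.
Qed.

Lemma to_circle_continuous : continuous (@to_circle R).
Proof.
move=> t; apply/metricType_numDomainType.cvgrPdist_lt => e e0.
apply/nbhs_ballP; exists e => //= s; rewrite /ball/= distrC => st.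
by rewrite -(subrK t s) addrC to_circleD (le_lt_trans (mdist_shift_le _ _)).
Qed.

Lemma circle_compact : compact [set: circle R].
Proof.
have -> : [set: circle R] = @to_circle R @` `[0, 1]%classic.
  apply/esym/seteqP; split=> // x _; have [r <-] := to_circle_surj x.
  have [s s01 [n ->]] := to_circle_frac r.
  by exists s; rewrite ?to_circleDz//= in_itv.
apply: continuous_compact; last exact: segment_compact.
by apply: continuous_subspaceT; exact: to_circle_continuous.
Qed.

Lemma continuous_bounded_on f : continuous f -> exists M, forall x, `|f x| <= M.
Proof.
move=> cf; have [|r n|M fM] := @continuous_periodic_bounded R (f \o @to_circle R).
- move=> r; apply: continuous_comp; [exact: to_circle_continuous|exact: cf].
- by rewrite /= to_circleDz.
exists M => x; have [r <-] := to_circle_surj x.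
exact: fM.
Qed.

Variable d : nat.
Local Notation T := (@expanding_map R d).

Lemma iter_expanding_mapD n x t :
  iter n T (x + to_circle t) = iter n T x + to_circle (d%:R ^+ n * t).
Proof.
elim: n => [|n IHn]; first by rewrite expr0 mul1r.
by rewrite !iterS IHn /expanding_map mulrnDl -to_circleMn exprS -mulrA mulr_natl.
Qed.

Lemma expanding_mapD x t : T (x + to_circle t) = T x + to_circle (d%:R * t).
Proof. exact: (iter_expanding_mapD 1). Qed.

Lemma mdist_iter n x y : mdist (iter n T x) (iter n T y) <= d%:R ^+ n * mdist x y.
Proof.
have [t -> txy] := mdist_lift x y.
rewrite iter_expanding_mapD (le_trans (mdist_shift_le _ _))// -txy normrM.
by rewrite ger0_norm// exprn_ge0.
Qed.

Lemma lipK_comp_map K f : lipK K f -> lipK (d%:R * K) (f \o T).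
Proof.
move=> fK x y; rewrite (le_trans (fK _ _))// -mulrA mulrCA.
by rewrite ler_wpM2l ?(lipK_ge0 fK)// (mdist_iter 1).
Qed.

Lemma expanding_map_continuous : continuous T.
Proof.
move=> x; apply/(metricType_numDomainType.cvgrPdist_lt (FF := nbhs_filter x)).
move=> e e0; have d1 : 0 < d%:R + 1 :> R by rewrite ltr_wpDl.
apply/nbhs_ballP; exists (e / (d%:R + 1)); first by rewrite /= divr_gt0.
move=> y; rewrite ballEmdist /= ltr_pdivlMr// => xy.
rewrite (le_lt_trans (mdist_iter 1 x y))// (le_lt_trans _ xy)// mulrC.
by rewrite ler_wpM2l ?mdist_ge0// expr1 lerDl.
Qed.

Hypothesis d2 : (2 <= d)%N.

Let d_gt0 : 0 < d%:R :> R.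
Proof. by rewrite ltr0n (leq_trans _ d2). Qed.

(** Inverse branches contract: a displacement [t] of the image lifts to [t / d]. This is the source
    of the regularity of calibrated subactions. *)
Lemma preimage_lift x x' y : T y = x ->
  exists2 y', T y' = x' & mdist y y' <= mdist x x' / d%:R.
Proof.
move=> yx; have [t -> txx] := mdist_lift x x'.
exists (y + to_circle (t / d%:R)).
  by rewrite expanding_mapD yx mulrC divfK ?gt_eqF.
rewrite (le_trans (mdist_shift_le _ _))// normrM -txx.
by rewrite [`|_^-1|]ger0_norm// invr_ge0 ltW.
Qed.

Lemma preimage_max f x :
  exists2 y, T y = x & forall z, T z = x -> f z <= f y.
Proof.
have [r rx] := to_circle_surj x.
pose br (j : 'I_d) := to_circle ((r + j%:R) / d%:R).
have brT j : T (br j) = x.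
  have := expanding_mapD 0 ((r + j%:R) / d%:R).
  rewrite add0r /expanding_map mul0rn add0r => ->.
  rewrite mulrC divfK ?gt_eqF// -rx; apply/eqP.
  by rewrite to_circle_eq addrAC subrr add0r rpred_nat.
have j0 : 'I_d by exists 0%N; rewrite (leq_trans _ d2).
have [j _ jmax] := arg_maxP (fun j => f (br j)) (erefl (xpredT j0)).
exists (br j) => // z zx; have [s sz] := to_circle_surj z.
(* The points [br j] are all the preimages: if [d * s - r = k] and [k = q * d + m], then [s] and
   [(r + m) / d] differ by the integer [q]. *)
suff [i ->] : exists i, z = br i by apply: jmax.
have : to_circle (d%:R * s) = x.
  by rewrite -zx -sz -[to_circle s]add0r expanding_mapD /expanding_map mul0rn add0r.
move=> /esym/eqP; rewrite -rx eq_sym to_circle_eq => /intrP[k dsk].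
have d0 : (d%:Z != 0 :> int) by lia.
pose q := (k %/ d%:Z)%Z; pose m := (k %% d%:Z)%Z.
have kqm : k = q * d%:Z + m := divz_eq k d%:Z.
have m0 : 0 <= m := modz_ge0 k d0.
have md : m < d%:Z by rewrite ltz_pmod//; lia.
have mn : (`|m|%N < d)%N by lia.
exists (Ordinal mn); rewrite /br -sz; apply/eqP.
rewrite to_circle_eq (_ : _ - _ = q%:~R) ?intr_int//=.
have -> : s = (r + k%:~R) / d%:R by rewrite -dsk addrC subrK mulrAC divff ?mul1r// gt_eqF.
rewrite -mulrBl kqm intrD intrM -!pmulrn.
have -> : m%:~R = `|m|%:R :> R by rewrite -[in LHS](gez0_abs m0).
by apply: (canLR (mulfK _)); rewrite ?gt_eqF//; ring.
Qed.

End circle_geometry.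

(** * Discounted calibrated subactions *)

Section calibrated_subactions.
Context {R : realType}.
Variable d : nat.
Hypothesis d2 : (2 <= d)%N.
Implicit Types (A b f : circle R -> R) (K lam : R).
Local Notation T := (@expanding_map R d).

(** Passing from [x], [x'] to an optimal preimage of [x] and a nearby preimage of [x'] at least
    halves the distance, so the errors of [A] and of [lam * b] add up to at most [K] times the
    original distance, whatever [lam] is. The bound [M] on [b] enters with the factor [lam ^+ n] and
    disappears in the limit. *)
Lemma calibrated_lipK K lam A b : 0 <= lam < 1 -> lipK K A ->
  calibrated_subaction d lam A b -> lipK K b.
Proof.
move=> /andP[lam0 lam1] AK [cb bE]; have K0 := lipK_ge0 AK.
have [M bM] := continuous_bounded_on cb.
have key n x x' : b x - b x' <= lam ^+ n * (M + M) + K * mdist x x'.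
  elim: n x x' => [|n IHn] x x'.
    rewrite expr0 mul1r ler_wpDr ?mulr_ge0 ?mdist_ge0//.
    by rewrite (le_trans (ler_norm _))// (le_trans (ler_normB _ _))// lerD.
  have [[y yx byx] _] := bE x; have [_ bx'] := bE x'.
  have [y' yx' yy'] := preimage_lift d2 x' yx.
  have := bx' _ (ex_intro2 _ _ y' yx' erefl).
  have := IHn y y'; have := le_trans (ler_norm _) (AK y y').
  rewrite -byx exprS -(mulrA lam); move: (lam ^+ n * (M + M)) => c /= h1 h2 h3.
  have yy2 : mdist y y' + mdist y y' <= mdist x x'.
    have : mdist y y' * d%:R <= mdist x x'.
      by rewrite -ler_pdivlMr// ltr0n (leq_trans _ d2).
    by apply: le_trans; rewrite -mulr2n -[leLHS]mulr_natr ler_wpM2l ?mdist_ge0 ?ler_nat.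
  have := ler_wpM2l K0 yy2; have := ler_wpM2l lam0 h2.
  have : lam * (K * mdist y y') <= K * mdist y y'.
    by rewrite -[leRHS]mul1r ler_wpM2r ?mulr_ge0 ?mdist_ge0// ltW.
  rewrite mulrBr mulrDr; lra.
have bK x x' : b x - b x' <= K * mdist x x'.
  apply/ler_addgt0Pl => e e0.
  have : lam ^+ n * (M + M) @[n --> \oo] --> (0 : R).
    rewrite -[X in _ --> X](mul0r (M + M)); apply: cvgMl.
    by apply: cvg_expr; rewrite ger0_norm.
  move=> /cvgrPdist_le/(_ _ e0)[n _ /(_ n (leqnn n))] /=.
  rewrite sub0r normrN => /(le_trans (ler_norm _)) h.
  by rewrite (le_trans (key n x x'))// lerD2r.
move=> x x'; rewrite ler_norml bK andbT.
by rewrite lerNl opprB metric_sym bK.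
Qed.

(** Monotone iteration: the iterates of [L] from the constant [- C] increase, stay below [C] and
    share the Lipschitz constant [K], so their supremum is Lipschitz and fixed by [L]. *)
Lemma calibrated_exists K lam A : 0 < lam < 1 -> lipK K A ->
  exists b, calibrated_subaction d lam A b.
Proof.
move=> /andP[lam0 lam1] AK; have K0 := lipK_ge0 AK.
have [M AM] := continuous_bounded_on (lipK_continuous AK).
have pick f x : {y | T y = x & forall z, T z = x ->
    lam * f z + A z <= lam * f y + A y}.
  exact: cid2 (preimage_max d2 (fun y => lam * f y + A y) x).
pose L f x := lam * f (s2val (pick f x)) + A (s2val (pick f x)).
have Lub f z : lam * f z + A z <= L f (T z).
  by rewrite /L; case: (pick f (T z)) => y /= _; apply.
have Latt f x : exists2 y, T y = x & L f x = lam * f y + A y.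
  by rewrite /L; case: (pick f x) => y /= yx _; exists y.
have Llip f : lipK K f -> lipK K (L f).
  move=> fK; suff h x x' : L f x - L f x' <= K * mdist x x'.
    by move=> x x'; rewrite ler_norml h andbT lerNl opprB metric_sym h.
  have [y yx ->] := Latt f x.
  have [y' <- yy'] := preimage_lift d2 x' yx.
  have yy2 : mdist y y' + mdist y y' <= mdist x (T y').
    have : mdist y y' * d%:R <= mdist x (T y').
      by rewrite -ler_pdivlMr// ltr0n (leq_trans _ d2).
    by apply: le_trans; rewrite -mulr2n -[leLHS]mulr_natr ler_wpM2l ?mdist_ge0 ?ler_nat.
  have := Lub f y'; have := le_trans (ler_norm _) (AK y y').
  have h2 := le_trans (ler_norm _) (fK y y').
  have := ler_wpM2l K0 yy2; have := ler_wpM2l (ltW lam0) h2.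
  have : lam * (K * mdist y y') <= K * mdist y y'.
    by rewrite -[leRHS]mul1r ler_wpM2r ?mulr_ge0 ?mdist_ge0// ltW.
  lra.
have Lmono f g : (forall x, f x <= g x) -> forall x, L f x <= L g x.
  move=> fg x; have [y <- ->] := Latt f x.
  by rewrite (le_trans _ (Lub g y))// lerD2r ler_wpM2l// ltW.
(* The solution of [lam * C + M = C], where [M] bounds the absolute value of [A]: then [L] raises
   [- C] and preserves the upper bound [C]. *)
pose C := M / (1 - lam).
have CE : lam * C + M = C by rewrite /C; field; lra.
pose F n := iter n L (fun=> - C).
have Flip n : lipK K (F n).
  by elim: n => [|n IHn]; [exact: lipK_le K0 (lipK_cst _)|exact: Llip].
have Fub n x : F n x <= C.
  have M0 : 0 <= M := le_trans (normr_ge0 _) (AM 0).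
  elim: n x => [|n IHn] x.
    by rewrite /F /=; have : 0 <= C; [rewrite divr_ge0// subr_ge0 ltW|lra].
  rewrite [F _]/= -/(F n); have [y _ ->] := Latt (F n) x.
  by rewrite -CE lerD// ?ler_wpM2l// ?(ltW lam0)// (le_trans (ler_norm _)).
have Fle n x : F n x <= F n.+1 x.
  elim: n x => [|n IHn] x; last exact: Lmono.
  rewrite /F /=; have [y _ ->] := Latt (fun=> - C) x.
  by have := AM y; rewrite ler_norml => /andP[+ _]; lra.
pose S x := [set F n x | n in [set: nat]].
have Sub x : has_ubound (S x) by exists C => _ [n _ <-].
have S0 x : S x !=set0 by exists (F 0%N x), 0%N.
pose b x := sup (S x).
have bub n x : F n x <= b x by apply: ub_le_sup => //; exists n.
have ble x c : (forall n, F n x <= c) -> b x <= c.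
  by move=> h; apply: ge_sup => // _ [n _ <-].
have blip : lipK K b.
  suff h x x' : b x - b x' <= K * mdist x x'.
    by move=> x x'; rewrite ler_norml h andbT lerNl opprB metric_sym h.
  rewrite lerBlDr; apply: ble => n; rewrite -lerBlDr.
  have := le_trans (ler_norm _) (Flip n x x'); have := bub n x'; lra.
exists b; split; first exact: lipK_continuous blip.
have bge y : lam * b y + A y <= b (T y).
  rewrite -lerBrDr mulrC -ler_pdivlMr//; apply: ble => n.
  rewrite ler_pdivlMr// mulrC lerBrDr.
  exact: le_trans (Lub _ _) (bub n.+1 _).
move=> x /=; split; last by move=> _ [y <- <-].
have [y yx ymax] := preimage_max d2 (fun y => lam * b y + A y) x.
exists y => //; apply/eqP; rewrite eq_le -{1}yx bge/=; apply: ble => n.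
rewrite (le_trans (Fle n x))//= -/(F n); have [z /ymax zx ->] := Latt (F n) x.
by rewrite (le_trans _ zx)// lerD2r ler_wpM2l// ltW.
Qed.

(** Going back [n] times gives a point whose first [n] iterates are zeros of [phi]. A cluster point
    of these works for all times, each condition being closed. *)
Lemma zero_orbit (phi : circle R -> R) : continuous phi ->
  (forall x, exists2 y, T y = x & phi y = 0) ->
  exists p, forall i, phi (iter i T p) = 0.
Proof.
move=> cphi back.
have fin n : exists x, forall i, (i < n)%N -> phi (iter i T x) = 0.
  elim: n => [|n [x xn]]; first by exists 0.
  have [y yx y0] := back x; exists y => -[_|i /xn]; first exact: y0.
  by rewrite iterSr yx.
have {}fin n := cid (fin n).
pose u n := sval (fin n).
have [p [_ up]] := @circle_compact R (u @ \oo) _ filterT.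
exists p => i; pose Z := [set x | phi (iter i T x) = 0].
have cZ : closed Z.
  apply: (@closed_comp _ _ (phi \o iter i T) [set 0]); last exact: closed_eq.
  move=> x _; apply: continuous_comp; last exact: cphi.
  elim: i {Z} x => [|i IHi] x; first exact: cvg_id.
  by apply: continuous_comp; [exact: IHi|exact: expanding_map_continuous].
rewrite -[_ = 0]/(Z p); rewrite closure_id in cZ; rewrite cZ.
move=> B /up; apply; exists i.+1 => // n /= ni.
exact: (svalP (fin n)).
Qed.

Lemma calibrated_defect_lipK K L lam A b : lipK K A -> lipK L b ->
  lipK (d%:R * L + `|lam| * L + K) (fun x => b (T x) - lam * b x - A x).
Proof.
move=> AK bL; apply: lipKB AK; apply: (lipKB (f := b \o T)).
  exact: lipK_comp_map.
exact: lipKZ.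
Qed.

Lemma calibrated_zero_orbit K L lam A b :
  lipK K A -> lipK L b -> calibrated_subaction d lam A b ->
  exists p, forall i, b (T (iter i T p)) - lam * b (iter i T p) - A (iter i T p) = 0.
Proof.
move=> AK bL [cb bE].
apply: (zero_orbit (phi := fun x => b (T x) - lam * b x - A x)).
  exact: lipK_continuous (calibrated_defect_lipK lam AK bL).
move=> x; have [[y yx byx] _] := bE x; exists y => //.
by rewrite yx -byx; ring.
Qed.

Lemma calibrated_ge lam A b x : calibrated_subaction d lam A b ->
  0 <= b (T x) - lam * b x - A x.
Proof.
move=> [_ /(_ (T x))[_ ub]]; have := ub _ (ex_intro2 _ _ x erefl erefl) => /=.
lra.
Qed.

End calibrated_subactions.

(** * Closing and locking periodic orbits *)

Section birkhoff_sums.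
Context {R : realType}.
Variable d : nat.
Implicit Types (f g phi psi : circle R -> R) (K L D eps kappa t : R) (x y z : circle R).
Local Notation T := (@expanding_map R d).

Definition birkhoff f n x : R := \sum_(i < n) f (iter i T x).

Lemma birkhoff0 f x : birkhoff f 0 x = 0.
Proof. exact: big_ord0. Qed.

Lemma birkhoffD f m n x :
  birkhoff f (m + n) x = birkhoff f m x + birkhoff f n (iter m T x).
Proof.
rewrite /birkhoff big_split_ord /=; congr (_ + _).
by apply: eq_bigr => i _; rewrite addnC iterD.
Qed.

Lemma birkhoffS f n x : birkhoff f n.+1 x = f x + birkhoff f n (T x).
Proof. by rewrite -add1n birkhoffD /birkhoff big_ord1. Qed.

Lemma birkhoffSr f n x : birkhoff f n.+1 x = birkhoff f n x + f (iter n T x).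
Proof. by rewrite /birkhoff big_ord_recr. Qed.

Lemma birkhoff_shift f N y i : iter N T y = y ->
  birkhoff f N (iter i T y) = birkhoff f N y.
Proof.
move=> yN; elim: i => [//|i <-]; apply: (addrI (f (iter i T y))).
rewrite -birkhoffS birkhoffSr addrC; congr (f _ + _).
by rewrite -iterD addnC iterD yN.
Qed.

Lemma birkhoff_le f N n x : (forall z, 0 <= f z) -> (n <= N)%N ->
  birkhoff f n x <= birkhoff f N x.
Proof.
move=> f0 /subnKC <-; rewrite birkhoffD lerDl.
exact: sumr_ge0.
Qed.

Lemma birkhoff_lipK f K n x y : lipK K f ->
  birkhoff f n x <= birkhoff f n y + K * \sum_(i < n) mdist (iter i T x) (iter i T y).
Proof.
move=> fK; rewrite mulr_sumr -big_split /=; apply: ler_sum => i _.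
by rewrite -lerBlDl (le_trans (ler_norm _)).
Qed.

Hypothesis d2 : (2 <= d)%N.

Let d_ge2 : 2 <= d%:R :> R. Proof. by rewrite ler_nat. Qed.

(* The corrections [c i] solve [c i.+1 = d ^ n * c i - e i], where [e i] lifts
   the jump [z i.+1 - T ^ n (z i)]; the equation is linear, so no smallness of
   the jumps is needed. *)
Lemma closing n m (z : nat -> circle R) : (0 < n)%N -> (0 < m)%N -> z m = z 0%N ->
  exists2 y, iter (m * n) T y = y &
    \sum_(i < m) \sum_(r < n) mdist (iter (i * n + r) T y) (iter r T (z i)) <=
    \sum_(i < m) mdist (iter n T (z i)) (z i.+1).
Proof.
move=> n0 m0 zm.
have lift i : {t | z i.+1 = iter n T (z i) + to_circle t & `|t| = mdist (iter n T (z i)) (z i.+1)}.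
  exact: cid2 (mdist_lift _ _).
pose e i := s2val (lift i).
have zS i : z i.+1 = iter n T (z i) + to_circle (e i) by rewrite /e; case: (lift i).
have eE i : mdist (iter n T (z i)) (z i.+1) = `|e i| by rewrite /e; case: (lift i).
pose q : R := d%:R ^+ n.
have q1 : 1 < q by rewrite exprn_egt1 -?lt0n//; have := d_ge2; lra.
pose s := fix s i := if i is i'.+1 then q * s i' + e i' else 0.
have qm : q ^+ m - 1 != 0 by rewrite gt_eqF// subr_gt0 exprn_egt1 -?lt0n.
(* The initial value that makes the correction [m]-periodic: [q ^+ m * g - s m = g]. *)
pose g := s m / (q ^+ m - 1).
pose c i := q ^+ i * g - s i.
have cS i : c i.+1 = q * c i - e i by rewrite /c exprS /=; ring.
have c0 : c 0%N = g by rewrite /c expr0 mul1r subr0.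
have cm : c m = c 0%N by rewrite c0 /c /g; field.
have yE i : iter (i * n) T (z 0%N + to_circle g) = z i + to_circle (c i).
  elim: i => [|i IHi]; first by rewrite c0.
  rewrite mulSn iterD IHi iter_expanding_mapD cS to_circleB zS.
  by rewrite -/q -addrA [to_circle (e i) + _]addrC subrK.
exists (z 0%N + to_circle g); first by rewrite yE cm c0 zm.
(* Within a block the correction grows geometrically, with sum at most $(q-1)|c_i|$ since $d-1\ge
   1$. The recursion gives $q|c_i|\le |e_i|+|c_{i+1}|$, and summing over a period cancels the
   shift. *)
apply: (@le_trans _ _ (\sum_(i < m) (q - 1) * `|c i|)).
  apply: ler_sum => i _.
  apply: (@le_trans _ _ (\sum_(r < n) d%:R ^+ r * `|c i|)).
    apply: ler_sum => r _; rewrite addnC iterD yE iter_expanding_mapD.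
    rewrite metric_sym (le_trans (mdist_shift_le _ _))// normrM ger0_norm//.
  rewrite -mulr_suml ler_wpM2r//.
  have : 0 <= \sum_(r < n) d%:R ^+ r :> R by apply: sumr_ge0.
  rewrite subrX1 => S0; rewrite -[leLHS]mul1r ler_wpM2r//.
  by have := d_ge2; lra.
under [leRHS]eq_bigr do rewrite eE.
have shift : \sum_(i < m) `|c i.+1| = \sum_(i < m) `|c i|.
  apply: (addrI `|c 0%N|); have := erefl (\sum_(i < m.+1) `|c i|).
  by rewrite {1}big_ord_recl /= big_ord_recr /= cm [RHS]addrC.
have : \sum_(i < m) q * `|c i| <= \sum_(i < m) (`|e i| + `|c i.+1|).
  apply: ler_sum => i _; have -> : q * `|c i| = `|e i + c i.+1|.
    by rewrite cS addrC subrK normrM ger0_norm// ltW// (lt_trans ltr01).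
  exact: ler_normD.
rewrite big_split /= shift -!mulr_sumr; lra.
Qed.

Lemma closing1 n z : (0 < n)%N ->
  exists2 y, iter n T y = y &
    \sum_(r < n) mdist (iter r T y) (iter r T z) <= mdist (iter n T z) z.
Proof.
move=> n0; have [//|y yn] := @closing n 1 (fun=> z) n0 isT.
by rewrite !big_ord1 mul1n in yn * => ?; exists y.
Qed.

Definition orbit_separated y N D :=
  forall i j, (i < j < N)%N -> D <= mdist (iter i T y) (iter j T y).

(* If two points of the orbit are within [L * birkhoff phi N y], cut the orbit
   there and close up the shorter half: the period is halved while the Birkhoff
   sum grows at most by the factor [1 + K * L]. *)
Lemma well_separated_orbit a phi K L y N :
  lipK K phi -> (forall x, 0 <= phi x) -> 0 < L ->
  (0 < N <= 2 ^ a)%N -> iter N T y = y ->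
  birkhoff phi N y * (1 + K * L) ^+ a * L <= 1 ->
  exists y' N' D, [/\ (0 < N')%N, iter N' T y' = y', 0 < D <= 1,
    orbit_separated y' N' D & L * birkhoff phi N' y' <= D].
Proof.
move=> phiK phi0 L0; have K0 := lipK_ge0 phiK.
have KL1 : 1 <= 1 + K * L by rewrite lerDl mulr_ge0// ltW.
elim: a y N => [|a IHa] y N /andP[N0 Na] yN.
  have -> : N = 1%N by apply/eqP; rewrite eqn_leq Na.
  rewrite expr0 mulr1 mulrC => S1; exists y, 1%N, 1.
  split => //; first by have -> : 1%N = N by apply/eqP; rewrite eqn_leq N0.
  - by rewrite ltr01 lexx.
  - by move=> i [|j]//; rewrite andbC.
set S := birkhoff phi N y => Sa.
have S0 : 0 <= S by exact: sumr_ge0.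
have [[i [j [ij jN ijS]]]|none] := pselect (exists i j, [/\ (i < j)%N, (j < N)%N &
    mdist (iter i T y) (iter j T y) <= L * S]).
  have [x [n [n0 na nN Sx xn]]] : exists x n, [/\ (0 < n)%N, (n <= 2 ^ a)%N, (n <= N)%N,
      birkhoff phi N x = S & mdist (iter n T x) x <= L * S].
    (* One of the two arcs between the close points has length at most [2 ^ a]: either the arc from
       time [i] to [j], or the one from [j] around to [N + i]. *)
    have [pa|pa] := leqP (j - i) (2 ^ a).
      exists (iter i T y), (j - i)%N; split=> //; try lia.
      - exact: birkhoff_shift.
      - by rewrite -iterD subnK ?(ltnW ij)// metric_sym.
    exists (iter j T y), (N - (j - i))%N; split=> //; try lia.
    - by rewrite expnS in Na; lia.
    - exact: birkhoff_shift.
    - rewrite -iterD (_ : (_ + j = i + N)%N); last by lia.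
      by rewrite iterD yN.
  have [y' y'n y'x] := closing1 x n0.
  apply: (IHa y' n) => //; first by rewrite n0.
  apply: le_trans Sa; rewrite exprS mulrA ler_wpM2r ?(ltW L0)//.
  rewrite ler_wpM2r ?exprn_ge0 ?(le_trans _ KL1)//.
  rewrite (le_trans (birkhoff_lipK n y' x phiK))//.
  have -> : S * (1 + K * L) = S + K * (L * S) by ring.
  rewrite lerD// ?ler_wpM2l ?(le_trans y'x)//.
  by rewrite -Sx birkhoff_le.
have far i j : (i < j < N)%N -> L * S < mdist (iter i T y) (iter j T y).
  move=> /andP[ij jN]; rewrite ltNge; apply/negP => ijS.
  by apply: none; exists i, j.
(* The default 1 caps [D], and is its value when [N = 1]. It respects [L * S <= D] because the
   hypothesis on the Birkhoff sum yields [L * S <= 1]. *)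
pose D := \big[Num.min/1]_(p : 'I_N * 'I_N | (p.1 < p.2)%N) mdist (iter p.1 T y) (iter p.2 T y).
have LS0 : 0 <= L * S by rewrite mulr_ge0// ltW.
exists y, N, D; split => //.
- rewrite bigmin_le_id andbT; apply/bigmin_gtP; split=> // -[i j] /= ij.
  by rewrite (le_lt_trans LS0)// far// ij ltn_ord.
- move=> i j /andP[ij jN].
  exact: (bigmin_inf (Ordinal (ltn_trans ij jN), Ordinal jN)).
- apply/bigmin_geP; split=> [|[i j] /= ij]; last by rewrite ltW// far// ij ltn_ord.
  rewrite mulrC (le_trans _ Sa)// ler_wpM2r ?(ltW L0)//.
  by rewrite ler_peMr// exprn_ege1.
Qed.

End birkhoff_sums.

(** * Locking a separated periodic orbit *)

Section locking.
Context {R : realType}.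
Variable d : nat.
Hypothesis d2 : (2 <= d)%N.
Implicit Types (f g phi psi : circle R -> R) (K L D eps kappa t : R) (x y z : circle R).
Local Notation T := (@expanding_map R d).

(** The default 1 bounds all distances on the circle, so for [0 < N] this is the true distance to
    the orbit. *)
Definition orbit_dist y N x : R := \big[Num.min/1]_(i < N) mdist x (iter i T y).

Lemma orbit_dist_le y N x i : (i < N)%N -> orbit_dist y N x <= mdist x (iter i T y).
Proof. by move=> iN; exact: (bigmin_inf (Ordinal iN)). Qed.

Lemma orbit_dist_ge y N x c : c <= 1 ->
  (forall i, (i < N)%N -> c <= mdist x (iter i T y)) -> c <= orbit_dist y N x.
Proof. by move=> c1 h; apply/bigmin_geP; split=> // i _; exact: h. Qed.

Lemma orbit_dist_ge0 y N x : 0 <= orbit_dist y N x.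
Proof. by apply: orbit_dist_ge => // i _; exact: mdist_ge0. Qed.

Lemma orbit_dist_le1 y N x : orbit_dist y N x <= 1.
Proof. exact: bigmin_le_id. Qed.

Lemma orbit_dist_lt y N x c : (0 < N)%N -> orbit_dist y N x < c ->
  exists2 i, (i < N)%N & mdist x (iter i T y) < c.
Proof.
move=> N0 xc; apply: contrapT => h.
have {}h i : (i < N)%N -> c <= mdist x (iter i T y).
  by move=> iN; rewrite leNgt; apply/negP => ic; apply: h; exists i.
move: xc; rewrite ltNge orbit_dist_ge//.
exact: le_trans (h 0%N N0) (circle_dist_le1 _ _).
Qed.

Lemma orbit_dist_lipK y N : lipK 1 (orbit_dist y N).
Proof.
have h x x' : orbit_dist y N x - orbit_dist y N x' <= mdist x x'.
  rewrite lerBlDr -lerBlDl; apply: orbit_dist_ge => [|i iN].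
    by rewrite lerBlDr (le_trans (orbit_dist_le1 _ _ _))// lerDl mdist_ge0.
  rewrite lerBlDl (le_trans (orbit_dist_le _ _ iN))//.
  exact: metric_triangle.
move=> x x'; rewrite mul1r ler_norml h andbT lerNl opprB metric_sym.
exact: h.
Qed.

Lemma orbit_dist_orbit y N i : (i < N)%N -> orbit_dist y N (iter i T y) = 0.
Proof.
move=> iN; apply/eqP; rewrite eq_le orbit_dist_ge0 andbT.
by rewrite (le_trans (orbit_dist_le _ _ iN))// mdistxx.
Qed.

Lemma orbit_dist_shift y N D i t : D <= 1 -> orbit_separated d y N D -> (i < N)%N ->
  `|t| <= D / 2 -> `|t| <= orbit_dist y N (iter i T y + to_circle t).
Proof.
move=> D1 sepD iN tD; apply: orbit_dist_ge => [|j jN]; first lra.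
have [->|ij] := eqVneq i j.
  by rewrite metric_sym mdist_shift//; lra.
have : D <= mdist (iter i T y) (iter j T y).
  have [ltij|ltji|eqij] := ltngtP i j; first by apply: sepD; rewrite ltij.
    by rewrite metric_sym; apply: sepD; rewrite ltji.
  by rewrite eqij eqxx in ij.
have := metric_triangle (iter i T y) (iter i T y + to_circle t) (iter j T y).
have := mdist_shift_le (iter i T y) t.
lra.
Qed.

Let d_ge2 : 2 <= d%:R :> R. Proof. by rewrite ler_nat. Qed.

Let sum_expr n : \sum_(k < n.+1) d%:R ^+ k <= 2 * d%:R ^+ n :> R.
Proof.
elim: n => [|n IHn]; first by rewrite big_ord1 expr0; lra.
rewrite big_ord_recr /= exprS.
have : 0 <= d%:R ^+ n :> R by rewrite exprn_ge0.
have := d_ge2; move: (d%:R ^+ n) IHn => c IHn; nra.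
Qed.

Section locked_orbit.
Variables (psi : circle R -> R) (K eps kappa D : R) (y : circle R) (N : nat).
Hypotheses (psiK : lipK K psi) (eps0 : 0 < eps) (kappa0 : 0 <= kappa).
Hypotheses (N0 : (0 < N)%N) (yN : iter N T y = y) (D1 : D <= 1).
Hypothesis sepD : orbit_separated d y N D.
Hypothesis psiN : birkhoff d psi N y = 0.
Hypothesis psi_le : forall x, psi x <= kappa - eps * orbit_dist y N x.
(** The first term bounds an incomplete period along the orbit itself. The second bounds the
    Lipschitz errors of a point drifting away until its distance reaches [kappa / eps], beyond which
    [psi <= 0]. *)
Let C := N%:R * kappa + 2 * K * (kappa / eps).
Hypothesis CD : C + kappa <= eps * (D / (2 * d%:R)).

Let psi_le_kappa x : psi x <= kappa.
Proof.
by rewrite (le_trans (psi_le x))// gerBl mulr_ge0 ?orbit_dist_ge0// ltW.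
Qed.

Let iter_mod k : exists2 i, (i < N)%N & iter k T y = iter i T y.
Proof.
exists (k %% N)%N; first by rewrite ltn_mod.
rewrite {1}(divn_eq k N) addnC iterD; congr (iter _ _ _).
elim: (k %/ N)%N => [//|q IHq].
by rewrite mulSn iterD IHq.
Qed.

Let birkhoff_orbit l i : birkhoff d psi l (iter i T y) <= N%:R * kappa.
Proof.
elim/ltn_ind: l => l IHl; have [lN|Nl] := ltnP l N.
  rewrite (le_trans (ler_sum _ (fun k _ => psi_le_kappa _)))//.
  by rewrite sumr_const card_ord -[leLHS]mulr_natl ler_wpM2r// ler_nat ltnW.
rewrite -(subnKC Nl) birkhoffD birkhoff_shift// psiN add0r.
by rewrite -iterD addnC iterD yN; apply: IHl; lia.
Qed.

(** Final terms at distance at least [kappa / eps] are nonpositive and are dropped. Once the last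
    displacement is below [kappa / eps], all displacements are dominated by a geometric series with
    sum at most twice that, and the sum is compared with that of the orbit. *)
Let birkhoff_near i t l : (i < N)%N ->
  (forall k, (k < l)%N -> d%:R ^+ k * `|t| <= D / 2) ->
  birkhoff d psi l (iter i T y + to_circle t) <= C.
Proof.
move=> iN; have K0 := lipK_ge0 psiK.
have ke0 : 0 <= kappa / eps by rewrite divr_ge0// ltW.
have C0 : 0 <= C by rewrite /C addr_ge0 // !mulr_ge0 // invr_ge0 ltW.
elim: l => [|l IHl] small; first by rewrite birkhoff0.
have [far|close] := leP (kappa / eps) (d%:R ^+ l * `|t|).
  rewrite birkhoffSr -[leRHS]addr0 lerD//.
    by apply: IHl => k kl; apply: small; rewrite ltnW.
  rewrite (le_trans (psi_le _))// subr_le0 mulrC -ler_pdivrMr//.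
  rewrite (le_trans far)// iter_expanding_mapD -iterD.
  have [j jN ->] := iter_mod (l + i).
  have tE : `|d%:R ^+ l * t| = d%:R ^+ l * `|t|.
    by rewrite normrM ger0_norm.
  by rewrite -tE; apply: (@orbit_dist_shift _ _ D) => //; rewrite tE small.
rewrite (le_trans (birkhoff_lipK d l.+1 _ (iter i T y) psiK))//.
rewrite lerD ?birkhoff_orbit// (mulrC 2) -mulrA ler_wpM2l//.
apply: (@le_trans _ _ (\sum_(k < l.+1) d%:R ^+ k * `|t|)).
  apply: ler_sum => k _; rewrite iter_expanding_mapD metric_sym.
  rewrite (le_trans (mdist_shift_le _ _))// normrM ger0_norm//.
rewrite -mulr_suml (le_trans (ler_wpM2r _ (sum_expr l)))//.
by rewrite -mulrA ler_wpM2l// ltW.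
Qed.

(* Each visit to the [kappa / eps]-neighbourhood of the orbit costs at most [C];
   leaving it, the point passes at distance between [D / (2 d)] and [D / 2],
   which pays for the visit. *)
Lemma birkhoff_locked n x : birkhoff d psi n x <= C.
Proof.
have K0 := lipK_ge0 psiK.
have ke0 : 0 <= kappa / eps by rewrite divr_ge0// ltW.
have C0 : 0 <= C by rewrite /C addr_ge0 // !mulr_ge0 // invr_ge0 ltW.
have d0 : 0 < d%:R :> R by have := d_ge2; lra.
pose r := D / (2 * d%:R).
have keD : kappa / eps <= r.
  rewrite ler_pdivrMr// mulrC (le_trans _ CD)//; lra.
have rD : d%:R * r = D / 2 by rewrite /r; field; rewrite gt_eqF.
elim/ltn_ind: n x => -[_ x|n IHn x]; first by rewrite birkhoff0.
have [far|close] := leP (kappa / eps) (orbit_dist y N x).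
  rewrite birkhoffS -[leRHS]add0r lerD ?IHn//.
  by rewrite (le_trans (psi_le _))// subr_le0 mulrC -ler_pdivrMr.
have [i iN] := orbit_dist_lt N0 close; rewrite metric_sym.
have [t -> <-] := mdist_lift (iter i T y) x; move=> tke.
have [stay|leave] := pselect (forall k, (k < n.+1)%N -> d%:R ^+ k * `|t| <= r).
  apply: birkhoff_near => // k /stay /le_trans; apply.
  have : 0 <= r := le_trans ke0 keD.
  by rewrite -rD; have := d_ge2; nra.
have exm : exists m, (m < n.+1)%N && (r < d%:R ^+ m * `|t|).
  apply: contrapT => h; apply: leave => k kn; rewrite leNgt; apply/negP => kt.
  by apply: h; exists k; rewrite kn.
(* [m] is the first time the displacement exceeds [r]. One step multiplies it by [d], so it is then
   still at most [d * r = D / 2], and [orbit_dist_shift] identifies it with a lower bound for the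
   distance to the orbit. *)
case: (ex_minnP exm) => m /andP[mn rm] mmin.
have small k : (k < m)%N -> d%:R ^+ k * `|t| <= r.
  move=> km; rewrite leNgt; apply/negP => kr.
  have := mmin k; rewrite kr (ltn_trans km mn) => /(_ isT).
  by rewrite leqNgt km.
have m0 : (0 < m)%N.
  rewrite lt0n; apply/eqP => m0; move: rm; rewrite m0 expr0 mul1r.
  by rewrite ltNge (le_trans (ltW tke)).
have mD : d%:R ^+ m * `|t| <= D / 2.
  by rewrite -(prednK m0) exprS -mulrA -rD ler_wpM2l// ?small ?prednK// ltW.
have -> : n.+1 = (m.+1 + (n - m))%N by rewrite addSn subnKC.
rewrite birkhoffD -[leRHS]add0r; apply: lerD; last by apply: IHn; rewrite ltnS leq_subr.
rewrite birkhoffSr; apply: (@le_trans _ _ (C + (kappa - eps * r))); last first.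
  by rewrite addrA subr_le0.
rewrite lerD//.
  apply: birkhoff_near => // k /small /le_trans; apply.
  have : 0 <= r := le_trans ke0 keD.
  by rewrite -rD; have := d_ge2; nra.
rewrite (le_trans (psi_le _))// lerD2l lerN2 ler_wpM2l ?(ltW eps0)//.
rewrite iter_expanding_mapD -iterD; have [j jN ->] := iter_mod (m + i).
have tE : `|d%:R ^+ m * t| = d%:R ^+ m * `|t|.
  by rewrite normrM ger0_norm.
rewrite (le_trans (ltW rm))// -tE.
by apply: (@orbit_dist_shift _ _ D) => //; rewrite tE.
Qed.

End locked_orbit.
End locking.

(** * Paths without short cycles *)

Section path_counting.
Variables (V : finType) (e : rel V) (k : nat).
Hypothesis no_cycle : forall s : seq V, (0 < size s <= k)%N -> ~~ cycle e s.

(* The order is reachability inside [W]. *)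
Lemma short_cycle_free_order (W : seq V) : (size W <= k)%N ->
  exists r : rel V, [/\ transitive r, irreflexive r &
    forall x y, y \in W -> e x y -> r x y].
Proof.
move=> Wk; pose P x y p := [/\ path e x p, p != [::], last x p = y & {subset p <= W}].
pose r : rel V := fun x y => `[< exists p, P x y p >].
exists r; split.
- move=> y x z /asboolP[p [ep p0 py pW]] /asboolP[q [eq q0 qz qW]].
  apply/asboolP; exists (p ++ q); split.
  + by rewrite cat_path ep py.
  + by case: p p0 {ep py pW}.
  + by rewrite last_cat py.
  + by move=> v; rewrite mem_cat => /orP[/pW|/qW].
- move=> x; apply/asboolP => -[[|y q] [//= /andP[exy eq] _ qx qW]].
  (* The closed walk is shortened to one with distinct vertices in [W], hence of length at most [k],
     which [no_cycle] excludes. *)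
  case: (shortenP eq) qx => q' eq' uq' qq' q'x.
  have q'W : (size (y :: q') <= k)%N.
    rewrite (leq_trans _ Wk)// uniq_leq_size// => v; rewrite in_cons => /orP[/eqP ->|/qq' vq].
      by apply: qW; rewrite mem_head.
    by apply: qW; rewrite in_cons vq orbT.
  have := @no_cycle (y :: q') q'W; rewrite /= rcons_path eq' q'x exy.
  by move=> /negP; apply.
- move=> x y yW exy; apply/asboolP; exists [:: y]; split=> //=; first by rewrite exy.
  by move=> v; rewrite inE => /eqP ->.
Qed.

Lemma short_cycle_free_sorted_uniq s :
  (size s <= k)%N -> sorted e s -> uniq s.
Proof.
move=> sk es; have [r [rt ri er]] := short_cycle_free_order sk.
apply: (sorted_uniq rt ri).
by apply: (sub_in_sorted (P := mem s)) es; [move=> x y _ ys; exact: er|apply/allP].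
Qed.

(** Both paths are sorted for the same strict order, and a strictly sorted sequence is determined by
    its elements. *)
Lemma short_cycle_free_sorted_inj s t :
  (size s <= k)%N -> sorted e s -> sorted e t -> s =i t -> s = t.
Proof.
move=> sk es et st; have [r [rt ri er]] := short_cycle_free_order sk.
apply: (irr_sorted_eq rt ri) => //.
  by apply: (sub_in_sorted (P := mem s)) es; [move=> x y _ ys; exact: er|apply/allP].
apply: (sub_in_sorted (P := mem s)) et; first by move=> x y _ ys; exact: er.
by apply/allP => x; rewrite -st.
Qed.

(** A path of [k] vertices is recovered from its set of vertices, so subsets are counted instead of
    sequences. Compared with [#|A| ^ k] this gains a factor [k ^ k] up to [4 ^ k], by
    [bin_expn_le]. *)
Lemma card_short_cycle_free (I : finType) (U : {set I}) (u : I -> seq V) (A : {set V}) :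
  (forall i, i \in U -> [/\ size (u i) = k, sorted e (u i) & {subset u i <= A}]) ->
  {in U &, injective u} -> (#|U| <= 'C(#|A|, k))%N.
Proof.
move=> uU u_inj; rewrite -cards_draws.
rewrite -(@card_in_imset _ _ (fun i => finset (mem (u i)))); last first.
  move=> i j iU jU /setP ij; apply: u_inj => //.
  have [[ki ei _] [_ ej _]] := (uU i iU, uU j jU).
  apply: short_cycle_free_sorted_inj => //; first by rewrite ki.
  by move=> x; have := ij x; rewrite !inE.
apply: subset_leq_card. apply/fintype.subsetP => _ /imsetP[i iU ->].
have [ki ei uiA] := uU i iU; rewrite !inE; apply/andP; split.
  by apply/fintype.subsetP => x; rewrite inE => /uiA.

rewrite cardsE (card_uniqP _) ?ki//.
by apply: short_cycle_free_sorted_uniq; rewrite ?ki.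
Qed.

End path_counting.

(** Combines $\binom{M}{k}k!\le M^k$ with $k^k\le (2k)(2k-1)\cdots(k+1)=\binom{2k}{k}k!\le 4^k
    k!$. *)
Lemma bin_expn_le M k : ('C(M, k) * k ^ k <= (4 * M) ^ k)%N.
Proof.
have ub n j : (n ^_ j <= n ^ j)%N.
  elim: j => [//|j IHj]; rewrite ffactnSr expnSr leq_mul//; exact: leq_subr.
have lb j : (j <= k)%N -> (k ^ j <= (k + k) ^_ j)%N.
  elim: j => [//|j IHj jk]; rewrite ffactnSr expnSr leq_mul ?IHj//; lia.
have kk : (k ^ k <= k`! * 4 ^ k)%N.
  rewrite (leq_trans (lb k (leqnn k)))// -bin_ffact mulnC leq_mul2l.
  apply/orP; right; have -> : (4 ^ k = 2 ^ (k + k))%N by rewrite expnD -expnMn.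
  rewrite -[in leqRHS](card_ord (k + k)) -cardsT -card_powerset -[in leqLHS](card_ord (k + k)).
  rewrite -cardsT -cards_draws; apply/subset_leq_card/fintype.subsetP => A.
  by rewrite !inE => /andP[].
rewrite (leq_trans (leq_mul (leqnn _) kk))// mulnA bin_ffact expnMn mulnC.
by rewrite leq_mul2l ub orbT.
Qed.

(** * Words and short cycles *)

Section growth.
Context {R : realType}.
Implicit Types (c r x : R).

Lemma expr_eventually_ge r x : 1 < r -> exists N, forall n, (N <= n)%N -> x <= r ^+ n.
Proof.
move=> r1; have r10 : 0 < r - 1 by rewrite subr_gt0.
have bernoulli n : 1 + n%:R * (r - 1) <= r ^+ n.
  elim: n => [|n IHn]; first by rewrite mul0r addr0 expr0.
  have r0 : 0 <= r by lra.
  rewrite exprS -natr1; apply: le_trans (ler_wpM2l r0 IHn).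
  have : 0 <= n%:R * ((r - 1) * (r - 1)) by rewrite !mulr_ge0 ?ler0n ?(ltW r10).
  lra.
exists (Num.bound (x / (r - 1))) => n Nn.
rewrite (le_trans _ (bernoulli n))// ler_wpDl// -ler_pdivrMr//.
rewrite (le_trans (ler_norm _))// (le_trans (ltW (archi_boundP (normr_ge0 _))))//.
by rewrite ler_nat (leq_trans _ Nn)// /Num.bound normr_id.
Qed.

Lemma natr_eventually_le_expr r x : 1 < r ->
  exists N, forall n, (N <= n)%N -> x * n%:R <= r ^+ n.
Proof.
move=> r1; pose c := ln r; have c0 : 0 < c by exact: ln_gt0.
have rE : r = expR c by rewrite lnK// posrE; lra.
exists (Num.bound (2 * x / c ^+ 2)) => n Nn.
rewrite rE -expRM_natl (le_trans _ (expR_ge1Dxn 1 _))//; last first.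
  by rewrite mulr_ge0// ltW.
have : 2 * x / c ^+ 2 <= n%:R.
  rewrite (le_trans (ler_norm _))// (le_trans (ltW (archi_boundP (normr_ge0 _))))//.
  by rewrite ler_nat (leq_trans _ Nn)// /Num.bound normr_id.
rewrite ler_pdivrMr ?exprn_gt0// => h.
have := ler_wpM2l (ler0n R n) h.
rewrite exprMn expr2 (_ : 2`! = 2)%N//; move: (n%:R) (c ^+ 2) => a b; lra.
Qed.

End growth.

Section words.
Context {R : realType}.
Variable d : nat.
Hypothesis d2 : (2 <= d)%N.
Implicit Types (x y z : circle R).
Local Notation T := (@expanding_map R d).

Let d_gt0 : 0 < d%:R :> R.
Proof. by rewrite ltr0n (leq_trans _ d2). Qed.

Lemma circle_frac x : {r : R | to_circle r = x & 0 <= r < 1}.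
Proof.
apply: cid2; have [r rx] := to_circle_surj x.
exists (r - (Num.floor r)%:~R).
  by apply/eqP; rewrite -rx to_circle_eq addrAC subrr sub0r rpredN intr_int.
by have := floor_itv r; rewrite intrD => /andP[rl ru]; apply/andP; split; lra.
Qed.

Definition lift01 x : R := s2val (circle_frac x).

Lemma lift01K x : to_circle (lift01 x) = x.
Proof. by rewrite /lift01; case: (circle_frac x). Qed.

Lemma lift01_itv x : 0 <= lift01 x < 1.
Proof. by rewrite /lift01; case: (circle_frac x). Qed.

Lemma lift01_to_circle r : 0 <= r < 1 -> lift01 (to_circle r) = r.
Proof.
move=> r01; have /eqP := lift01K (to_circle r); rewrite to_circle_eq => rZ.
apply/eqP; rewrite -subr_eq0; apply: contraT => /(norm_intr_ge1 rZ).
rewrite leNgt ltr_norml; have := lift01_itv (to_circle r); lra.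
Qed.

Lemma digit_subproof x : (Num.truncn (d%:R * lift01 x) < d)%N.
Proof.
have /andP[f0 f1] := lift01_itv x.
have /andP[+ _] := truncn_itv (mulr_ge0 (ltW d_gt0) f0).
move=> /le_lt_trans -/(_ d%:R); rewrite ltr_nat; apply.
by rewrite -[ltRHS]mulr1 ltr_pM2l.
Qed.

Definition digit x : 'I_d := Ordinal (digit_subproof x).

Lemma lift01_expanding_map x : lift01 (T x) = d%:R * lift01 x - (digit x : nat)%:R.
Proof.
have /andP[f0 f1] := lift01_itv x.
have /andP[lo hi] := truncn_itv (mulr_ge0 (ltW d_gt0) f0).
rewrite -[RHS]lift01_to_circle/=; last by rewrite -natr1 in hi; apply/andP; split; lra.
congr lift01; have := expanding_mapD d 0 (lift01 x).
rewrite add0r lift01K => ->; rewrite /expanding_map mul0rn add0r.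
by apply/eqP; rewrite to_circle_eq opprB addrC subrK rpred_nat.
Qed.

(** In the coordinate [lift01], [T] is affine of slope [d] on each digit interval: while digits
    agree, the difference of the lifts is multiplied by exactly [d], yet it stays at most 1. *)
Lemma mdist_same_digits n x y :
  (forall i, (i < n)%N -> digit (iter i T x) = digit (iter i T y)) ->
  d%:R ^+ n * mdist x y <= 1.
Proof.
move=> same.
suff h : d%:R ^+ n * `|lift01 x - lift01 y| <= 1.
  apply: le_trans h; rewrite ler_wpM2l//.
  have xE : x = y + to_circle (lift01 x - lift01 y).
    by rewrite to_circleB !lift01K addrC subrK.
  by rewrite metric_sym {1}xE mdist_shift_le.
elim: n x y same => [|n IHn] x y same.
  rewrite expr0 mul1r ler_norml.
  by have := lift01_itv x; have := lift01_itv y; lra.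
have {IHn} := IHn (T x) (T y) _; rewrite !lift01_expanding_map.
rewrite (same 0%N isT) opprB addrA subrK -mulrBr normrM ger0_norm ?(ltW d_gt0)//.
rewrite exprSr mulrA; apply => i iN.
by rewrite -!iterSr same.
Qed.

Definition word n x : {ffun 'I_n -> 'I_d} := [ffun i : 'I_n => digit (iter i T x)].

Lemma word_digit n x y i : word n x = word n y -> (i < n)%N ->
  digit (iter i T x) = digit (iter i T y).
Proof. by move=> /ffunP h iN; have := h (Ordinal iN); rewrite !ffunE. Qed.

Lemma mdist_same_word n x y : word n x = word n y -> mdist x y <= (d%:R ^+ n)^-1.
Proof.
move=> xy; rewrite -[leRHS]mul1r ler_pdivlMr ?exprn_gt0// mulrC.
by apply: mdist_same_digits => i; exact: word_digit.
Qed.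

Variable Z : set (circle R).
Hypothesis TZ : forall z, Z z -> Z (T z).
Hypothesis Z0 : Z !=set0.

Let iterZ n z : Z z -> Z (iter n T z).
Proof. by elim: n => //= n IHn /IHn; exact: TZ. Qed.

Definition admissible n : {set {ffun 'I_n -> 'I_d}} :=
  finset (fun w => `[< exists2 z, Z z & word n z = w >]).

(** A cycle of this graph is a periodic pseudo-orbit of [T ^ n] in [Z], with jumps at most
    [d ^ (- n)] by [mdist_same_word]. *)
Definition transition n : rel {ffun 'I_n -> 'I_d} := fun u v =>
  `[< exists z, [/\ Z z, word n z = u & word n (iter n T z) = v] >].

(** A word of length [k * n] splits into [k] blocks that form a path for [transition n] and
    determine the word. *)
Lemma card_admissible_le n k : (0 < n)%N ->
  (forall s : seq {ffun 'I_n -> 'I_d}, (0 < size s <= k)%N -> ~~ cycle (@transition n) s) ->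
  (#|admissible (k * n)| <= 'C(#|admissible n|, k))%N.
Proof.
move=> n0 nocyc.
have pick w : exists z, w \in admissible (k * n) -> Z z /\ word (k * n) z = w.
  have [|nw] := boolP (w \in admissible (k * n)); last by exists 0.
  by rewrite inE => /asboolP[z Zz zw]; exists z.
have {pick}[zz zzP] := choice pick.
pose u w := mkseq (fun i => word n (iter (i * n) T (zz w))) k.
apply: (card_short_cycle_free nocyc (u := u)).
  move=> w /zzP[Zz zw]; rewrite /u size_mkseq; split => //.
    apply/(sortedP (word n 0)) => i; rewrite size_mkseq => ik.
    rewrite !nth_mkseq ?(ltnW ik)//; apply/asboolP.
    exists (iter (i * n) T (zz w)); split=> //; first exact: iterZ.
    by rewrite -iterD.
  move=> v /mapP[i _ ->]; rewrite inE; apply/asboolP.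
  by exists (iter (i * n) T (zz w)) => //; exact: iterZ.
move=> w w' /zzP[_ zw] /zzP[_ zw'] uw; rewrite -zw -zw'.
apply/ffunP => j; rewrite !ffunE (divn_eq j n) addnC !iterD.
apply: (@word_digit n); last by rewrite ltn_mod.
have jk : (j %/ n < k)%N by rewrite ltn_divLR.
have /(congr1 (fun s => nth (word n 0) s (j %/ n))) := uw.
by rewrite !nth_mkseq.
Qed.

(* The growth rate [#|admissible n| ^ (1/n)] would drop by the factor [r] each
   time [n] is replaced by [k * n], which is impossible since it is at least 1
   (Bressaud-Quas, Quas-Siefken). *)
Lemma short_cycle_exists (r : R) n0 : 1 < r ->
  exists n (s : seq {ffun 'I_n -> 'I_d}), [/\ (n0 <= n)%N, (0 < n)%N, (0 < size s)%N,
    (size s)%:R <= (r ^+ 2) ^+ n + 1 & cycle (@transition n) s].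
Proof.
move=> r1; apply: contrapT => none; have r0 : 0 < r := lt_trans ltr01 r1.
have [N1 N1P] := expr_eventually_ge 4 r1.
pose n1 := maxn (maxn n0 N1) 1.
have step j : exists2 n, (n1 <= n)%N & #|admissible n|%:R <= (d%:R / r ^+ j) ^+ n :> R.
  elim: j => [|j [n n1n IHj]].
    exists n1 => //; rewrite expr0 divr1 -natrX ler_nat.
    by rewrite (leq_trans (max_card _))// card_ffun !card_ord.
  have n0' : (0 < n)%N by rewrite (leq_trans _ n1n)// leq_max orbT.
  (* With [k] just above [r ^ (2 * n)], the bound [(4 * p / k) ^ k] loses a factor 4 and gains
     [r ^ (2 * n)] inside the power. Since [4 <= r ^ n] for [n >= N1], a gain of [r ^ n] remains. *)
  pose k := (Num.truncn ((r ^+ 2) ^+ n)).+1.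
  have /andP[klo khi] := truncn_itv (exprn_ge0 n (exprn_ge0 2 (ltW r0))).
  have nocyc (s : seq {ffun 'I_n -> 'I_d}) : (0 < size s <= k)%N -> ~~ cycle (@transition n) s.
    move=> /andP[s0 sk]; apply/negP => cs; apply: none; exists n, s; split => //.
      by rewrite (leq_trans _ n1n)// !leq_max leqnn.
    by rewrite (le_trans (y := k%:R)) ?ler_nat// -natr1 lerD2r.
  have := card_admissible_le n0' nocyc.
  set P := #|admissible (k * n)|; set p := #|admissible n| in IHj *.
  move=> /(leq_mul (leqnn (k ^ k))); rewrite mulnC [X in (_ <= X)%N]mulnC.
  move=> /leq_trans/(_ (bin_expn_le p k)).
  rewrite -(ler_nat R) natrM !natrX natrM => Pk.
  exists (k * n)%N; first by rewrite (leq_trans n1n)// leq_pmull.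
  have k0 : 0 < k%:R :> R by rewrite ltr0n.
  rewrite -/P [in leRHS]mulnC exprM -(ler_pM2r (exprn_gt0 k k0)) (le_trans Pk)// -exprMn.
  rewrite lerXn2r ?nnegrE ?mulr_ge0 ?exprn_ge0 ?divr_ge0 ?exprn_ge0 ?(ltW r0)//.
  apply: (@le_trans _ _ (4 * (d%:R / r ^+ j) ^+ n)); first by rewrite ler_wpM2l.
  apply: (@le_trans _ _ ((d%:R / r ^+ j.+1) ^+ n * (r ^+ 2) ^+ n)); last first.
    by rewrite ler_wpM2l ?(ltW khi)// exprn_ge0// divr_ge0// exprn_ge0// ltW.
  have -> : (d%:R / r ^+ j.+1) ^+ n * (r ^+ 2) ^+ n = r ^+ n * (d%:R / r ^+ j) ^+ n.
    by rewrite -!exprMn; congr (_ ^+ n); rewrite exprS; field; rewrite ?expf_neq0 gt_eqF.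
  rewrite ler_wpM2r ?exprn_ge0 ?divr_ge0 ?exprn_ge0 ?(ltW r0)// N1P//.
  by rewrite (leq_trans _ n1n)// !leq_max leqnn orbT.
(* For this [j] the count in [step] would be below 1, although a point of the nonempty set [Z] has a
   word of every length. *)
have [j jP] := expr_eventually_ge (d%:R + 1) r1.
have [n n1n] := step j; have n0' : (0 < n)%N by rewrite (leq_trans _ n1n)// leq_max orbT.
apply/negP; rewrite -ltNge (lt_le_trans (y := 1))//.
  rewrite exprn_ilt1 -?lt0n// ?divr_ge0 ?exprn_ge0 ?(ltW r0)//.
  rewrite ltr_pdivrMr ?exprn_gt0// mul1r (lt_le_trans _ (jP j (leqnn j)))//.
  by rewrite ltrDl.
rewrite (ler_nat _ 1) card_gt0; apply/set0Pn; have [z Zz] := Z0.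
by exists (word n z); rewrite inE; apply/asboolP; exists z.
Qed.

End words.

(** * Periodic orbits with small Birkhoff sum *)

Section periodic_approximation.
Context {R : realType}.
Variable d : nat.
Hypothesis d2 : (2 <= d)%N.
Implicit Types (phi : circle R -> R) (x y z p : circle R) (K L D : R).
Local Notation T := (@expanding_map R d).

Lemma birkhoff_blocks phi m n x : birkhoff d phi (m * n) x =
  \sum_(i < m) \sum_(r < n) phi (iter (i * n + r) T x).
Proof.
elim: m => [|m IHm]; first by rewrite birkhoff0 big_ord0.
rewrite mulSn addnC birkhoffD IHm big_ord_recr /=; congr (_ + _).
by apply: eq_bigr => r _; rewrite -iterD addnC.
Qed.

(** A cycle of [m] blocks read in the zero set is a pseudo-orbit with [m] jumps of size at most
    [d ^ (- n)]. By [closing] the total distance to the resulting periodic orbit is at most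
    [m / d ^ n], and [phi] vanishes on the pseudo-orbit. *)
Lemma periodic_approximation phi K p n0 (r : R) :
  lipK K phi -> (forall i, phi (iter i T p) = 0) -> 1 < r ->
  exists n y N, [/\ (n0 <= n)%N, (0 < N)%N,
    N%:R <= n%:R * ((r ^+ 2) ^+ n + 1), iter N T y = y &
    birkhoff d phi N y <= K * ((r ^+ 2) ^+ n + 1) / d%:R ^+ n].
Proof.
move=> phiK phip r1; have K0 := lipK_ge0 phiK.
pose Z := [set x | forall i, phi (iter i T x) = 0].
have TZ z : Z z -> Z (T z) by move=> Zz i; rewrite -iterSr; exact: Zz.
have [n [s [n0n n1 s0 sr cs]]] := short_cycle_exists d2 TZ (ex_intro _ p phip) n0 r1.
set m := size s in s0 sr.
case: s @m s0 sr cs => [//|w s] m _ mr ws.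
pose l := w :: rcons s w; pose u i := nth w l i.
have lm : u m = w by rewrite /u /l /= nth_rcons ltnn eqxx.
have pick i : exists z, (i < m)%N -> [/\ Z z, word d2 n z = u i & word d2 n (iter n T z) = u i.+1].
  have [im|] := boolP (i < m)%N; last by exists 0.
  have /(pathP w)/(_ i) := ws; rewrite size_rcons => /(_ im)/asboolP[z [Zz z1 z2]].
  by exists z => _; split.
have {pick}[zz zzP] := choice pick.
pose z i := if (i < m)%N then zz i else zz 0%N.
have zm : z m = z 0%N by rewrite /z ltnn.
have [y yN yz] := closing d2 n1 (isT : (0 < m)%N) zm.
exists n, y, (m * n)%N; split => //; first by rewrite muln_gt0 n1.
  by rewrite natrM mulrC ler_wpM2l.
rewrite birkhoff_blocks.
have h1 : \sum_(i < m) \sum_(r < n) phi (iter (i * n + r) T y) <=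
    K * \sum_(i < m) \sum_(r < n) mdist (iter (i * n + r) T y) (iter r T (z i)).
  rewrite mulr_sumr; apply: ler_sum => i _; rewrite mulr_sumr; apply: ler_sum => j _.
  have [Zz _ _] := zzP i (ltn_ord i).
  rewrite -[leLHS]subr0 -(Zz j) /z ltn_ord.
  exact: le_trans (ler_norm _) (phiK _ _).
rewrite (le_trans h1)// -mulrA ler_wpM2l// (le_trans yz)//.
apply: (@le_trans _ _ (\sum_(i < m) (d%:R ^+ n)^-1)).
  apply: ler_sum => i _; have [_ _ zi] := zzP i (ltn_ord i).
  apply: (mdist_same_word (d2 := d2)); rewrite /z ltn_ord zi; case: ifPn => [im|].
    by have [_ -> _] := zzP _ im.
  rewrite -leqNgt => mi; have -> : i.+1 = m by apply/eqP; rewrite eqn_leq mi ltn_ord.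
  by rewrite lm; have [_ -> _] := zzP 0%N isT.
by rewrite sumr_const card_ord -[leLHS]mulr_natl ler_wpM2r// invr_ge0.
Qed.

Lemma zero_orbit_separated phi K L p : lipK K phi -> (forall x, 0 <= phi x) ->
  (forall i, phi (iter i T p) = 0) -> 0 < L ->
  exists y N D, [/\ (0 < N)%N, iter N T y = y, 0 < D <= 1,
    orbit_separated d y N D & L * birkhoff d phi N y <= D].
Proof.
move=> phiK phi0 phip L0; have K0 := lipK_ge0 phiK.
have [e eP] : exists e, 1 + K * L <= 2 ^+ e.
  have [e eP] := expr_eventually_ge (1 + K * L) (ltr1n R 2).
  by exists e; exact: eP.
(* Put [g = r ^ (2 * n)]. Then [2 ^ a <= g ^ 2], so the halvings cost at most
   [(1 + K * L) ^ a <= g ^ (2 * e)], and the initial sum is at most [K * g ^ 2 / d ^ n]. The choice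
   [r ^ q = 3 / 2] gives [g ^ (2 * e.+1) = (3 / 2) ^ n]; with [K * L <= (4 / 3) ^ n] the product is
   at most [2 ^ n <= d ^ n]. *)
pose q := (4 * e.+1)%N.
pose r : R := expR (ln (3 / 2) / q%:R).
have q0 : 0 < q%:R :> R by rewrite ltr0n.
have r1 : 1 < r by rewrite expR_gt1 divr_gt0// ln_gt0//; lra.
have rq : r ^+ q = 3 / 2.
  by rewrite -expRM_natl mulrC divfK ?gt_eqF// lnK// posrE; lra.
have r21 : 1 < r ^+ 2 by rewrite exprn_egt1.
have [N1 N1P] := natr_eventually_le_expr 4 r21.
have [N2 N2P] : exists N, forall n, (N <= n)%N -> K * L <= (4 / 3) ^+ n.
  by apply: expr_eventually_ge; lra.
have [n [y [N [nN N0 Nn yN yS]]]] :=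
  periodic_approximation (maxn (maxn N1 N2) 1) phiK phip r1.
have nN1 : (N1 <= n)%N by rewrite (leq_trans _ nN)// !leq_max leqnn.
have nN2 : (N2 <= n)%N by rewrite (leq_trans _ nN)// !leq_max leqnn orbT.
have n1 : 1 <= n%:R :> R by rewrite ler1n (leq_trans _ nN)// leq_max orbT.
have {N1P}N1P := N1P n nN1; have {N2P}N2P := N2P n nN2.
pose g := (r ^+ 2) ^+ n; rewrite -/g in N1P Nn yS.
have g4 : 4 <= g by lra.
pose a := (trunc_log 2 N).+1.
have /andP[lo hi] := @trunc_log_bounds 2 N isT N0.
have aN : (2 ^ a)%:R <= g ^+ 2.
  apply: (@le_trans _ _ (2 * N%:R)).
    by rewrite -natrM ler_nat expnS leq_mul2l.
  have h1 : n%:R * 1 <= n%:R * g by rewrite ler_wpM2l//; lra.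
  have h2 : 4 * n%:R * g <= g * g by rewrite ler_wpM2r//; lra.
  move: Nn h1 h2; rewrite expr2 mulrDr; lra.
apply: (@well_separated_orbit R d d2 a phi K L y N) => //.
  by rewrite N0 ltnW.
have KL0 : 0 <= 1 + K * L by rewrite addr_ge0 ?mulr_ge0// ltW.
have aE : (1 + K * L) ^+ a <= g ^+ (2 * e).
  apply: (@le_trans _ _ ((2 ^+ e) ^+ a)); first by rewrite lerXn2r ?nnegrE ?exprn_ge0.
  by rewrite exprAC exprM lerXn2r ?nnegrE ?exprn_ge0// -?natrX//; lra.
have gE : g ^+ (2 * e.+1) = (3 / 2) ^+ n.
  by rewrite /g -!exprM -rq -exprM mulnCA mulnC mulnA.
have dn0 : 0 < d%:R ^+ n :> R by rewrite exprn_gt0// ltr0n (leq_trans _ d2).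
apply: (@le_trans _ _ (K * g ^+ 2 / d%:R ^+ n * g ^+ (2 * e) * L)).
  rewrite ler_wpM2r ?(ltW L0)// ler_pM ?exprn_ge0//; first exact: sumr_ge0.
  rewrite (le_trans yS)// ler_wpM2r ?invr_ge0 ?(ltW dn0)// ler_wpM2l//; nra.
have -> : K * g ^+ 2 / d%:R ^+ n * g ^+ (2 * e) * L =
    (K * L) * g ^+ (2 * e.+1) / d%:R ^+ n.
  by rewrite mulnS exprD; ring.
rewrite ler_pdivrMr// mul1r gE.
apply: (@le_trans _ _ ((4 / 3) ^+ n * (3 / 2) ^+ n)).
  by rewrite ler_wpM2r// exprn_ge0//; lra.
rewrite -exprMn (_ : 4 / 3 * (3 / 2) = 2 :> R); last by field.
by rewrite lerXn2r ?nnegrE// ler_nat.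
Qed.

End periodic_approximation.

(** * Means of bounded measurable functions *)

Section circle_measures.
Context {R : realType}.
Implicit Types (f g : circle R -> R) (mu nu rho : probability (circle R) R).
Implicit Types (x y : circle R) (B : set (circle R)).

Lemma open_measurable_circle B : open B -> measurable B.
Proof. exact: sub_sigma_algebra. Qed.

Lemma continuous_measurable_circle f : continuous f -> measurable_fun setT f.
Proof.
move=> /continuousP cf; apply: (measurability _ (RGenOpens.measurableE R)).
move=> _ [_ [a [b ->] <-]]; rewrite setTI.
by apply: open_measurable_circle; apply: cf; exact: interval_open.
Qed.

Definition bounded_measurable f :=
  measurable_fun setT f /\ exists M, forall x, `|f x| <= M.

Lemma bounded_measurable_continuous f : continuous f -> bounded_measurable f.
Proof.
by move=> cf; split; [exact: continuous_measurable_circle|exact: continuous_bounded_on].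
Qed.

Lemma bounded_measurable_lipK K f : lipK K f -> bounded_measurable f.
Proof. by move=> /lipK_continuous; exact: bounded_measurable_continuous. Qed.

Lemma bounded_measurable_indic B : measurable B -> bounded_measurable (\1_B : circle R -> R).
Proof.
move=> mB; split; first exact: measurable_indic.
by exists 1 => x; rewrite indicE; case: (_ \in _); rewrite ?normr0 ?normr1.
Qed.

Lemma bounded_measurable_cst c : bounded_measurable (fun=> c).
Proof. by split; [exact: measurable_cst|exists `|c|]. Qed.

Lemma bounded_measurableD f g :
  bounded_measurable f -> bounded_measurable g -> bounded_measurable (f \+ g).
Proof.
move=> [mf [M fM]] [mg [N gN]]; split; first exact: measurable_funD.
by exists (M + N) => x; rewrite (le_trans (ler_normD _ _))// lerD.
Qed.

Lemma bounded_measurableZ c f :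
  bounded_measurable f -> bounded_measurable (fun x => c * f x).
Proof.
move=> [mf [M fM]]; split; first exact: measurable_funM.
by exists (`|c| * M) => x; rewrite normrM ler_wpM2l.
Qed.

Lemma bounded_measurable_integrable mu f :
  bounded_measurable f -> mu.-integrable setT (EFin \o f).
Proof.
move=> [mf [M fM]]; apply: measurable_bounded_integrable => //.
  by rewrite (le_lt_trans (probability_le1 _ _))// ltry.
by exists M; split; [exact: num_real|move=> r Mr x _ /=; exact: le_trans (fM x) (ltW Mr)].
Qed.

Local Notation J mu f := (\int[mu]_x f x).

Lemma meanE mu f : bounded_measurable f -> (\int[mu]_x (f x)%:E)%E = (J mu f)%:E.
Proof.
move=> bf; rewrite fineK//; apply: integrable_fin_num => //.
exact: bounded_measurable_integrable.
Qed.

Lemma meanD mu f g : bounded_measurable f -> bounded_measurable g ->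
  J mu (f \+ g) = J mu f + J mu g.
Proof. by move=> bf bg; rewrite RintegralD//; exact: bounded_measurable_integrable. Qed.

Lemma meanZ mu c f : bounded_measurable f -> J mu (fun x => c * f x) = c * J mu f.
Proof. by move=> bf; rewrite RintegralZl//; exact: bounded_measurable_integrable. Qed.

Lemma mean_cst mu c : J mu (fun=> c) = c.
Proof. by rewrite Rintegral_cst// [X in fine X]probability_setT mulr1. Qed.

Lemma mean_le mu f g : bounded_measurable f -> bounded_measurable g ->
  (forall x, f x <= g x) -> J mu f <= J mu g.
Proof. by move=> bf bg fg; apply: le_Rintegral => //; exact: bounded_measurable_integrable. Qed.

Lemma mean_ae_cst mu B f c : bounded_measurable f -> measurable B -> mu (~` B) = 0%E ->
  (forall x, B x -> f x = c) -> J mu f = c.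
Proof.
move=> bf mB B0 fc; rewrite -[RHS](mean_cst mu) /Rintegral; congr fine.
apply: ae_eq_integral => //; first by apply/measurable_EFinP; exact: bf.1.
exists (~` B); split => //; first exact: measurableC.
by move=> x /=; apply: contra_not => /fc -> _.
Qed.

Lemma mean_indic mu B : measurable B -> (J mu \1_B)%:E = mu B.
Proof.
move=> mB; rewrite -meanE; last exact: bounded_measurable_indic.
by rewrite integral_indic// setIT.
Qed.

Lemma mean_eq0 mu f : bounded_measurable f -> (forall x, 0 <= f x) -> J mu f = 0 ->
  mu [set x | f x != 0] = 0%E.
Proof.
move=> bf f0 Jf; have mf : measurable_fun setT (EFin \o f) by apply/measurable_EFinP; exact: bf.1.
have : (\int[mu]_x `|(EFin \o f) x| = 0)%E.
  rewrite (_ : (fun x => _) = EFin \o f); first by rewrite meanE// Jf.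
  by apply/funext => x /=; rewrite ger0_norm.
move/(ae_eq_integral_abs mu measurableT mf) => [N [mN N0 sN]].
have m : measurable [set x | f x != 0].
  rewrite (_ : [set x | _] = setT `&` f @^-1` (~` [set 0])).
    by apply: bf.1 => //; apply: measurableC; exact: measurable_set1.
  by rewrite setTI; apply/seteqP; split=> x /= /eqP.
apply: (subset_measure0 m mN _ N0) => x /= fx; apply: sN => /=.
by move=> /(_ Logic.I) [fx0]; rewrite fx0 eqxx in fx.
Qed.

Variable d : nat.
Local Notation T := (@expanding_map R d).

Lemma measurable_expanding_map : measurable_fun setT T.
Proof.
apply: (measurability (@open (circle R))) => //.
move=> _ [B oB <-]; rewrite setTI; apply: open_measurable_circle.
by move/continuousP: (@expanding_map_continuous R d); exact.
Qed.

HB.instance Definition _ := isMeasurableFun.Build _ _ _ _ T measurable_expanding_map.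

Lemma bounded_measurable_comp f : bounded_measurable f -> bounded_measurable (f \o T).
Proof.
move=> [mf [M fM]]; split; last by exists M => x; exact: fM.
exact: measurableT_comp mf measurable_expanding_map.
Qed.

Lemma bounded_measurable_iter f n :
  bounded_measurable f -> bounded_measurable (f \o iter n T).
Proof.
move=> bf; elim: n => [//|n /bounded_measurable_comp].
by congr bounded_measurable; apply/funext => x /=; rewrite -iterSr.
Qed.

Lemma birkhoff0_fun f : birkhoff d f 0 = fun=> 0.
Proof. by apply/funext => x; rewrite birkhoff0. Qed.

Lemma birkhoffSr_fun f n : birkhoff d f n.+1 = birkhoff d f n \+ (f \o iter n T).
Proof. by apply/funext => x; rewrite birkhoffSr. Qed.

Lemma bounded_measurable_birkhoff f n :
  bounded_measurable f -> bounded_measurable (birkhoff d f n).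
Proof.
move=> bf; elim: n => [|n IHn].
  by rewrite birkhoff0_fun; exact: bounded_measurable_cst.
rewrite birkhoffSr_fun; exact: bounded_measurableD IHn (bounded_measurable_iter n bf).
Qed.

Lemma mean_comp mu f : invariant_probability d mu -> bounded_measurable f ->
  J mu (f \o T) = J mu f.
Proof.
move=> imu bf; rewrite /Rintegral; congr fine.
have mf : measurable_fun setT (EFin \o f) by apply/measurable_EFinP; exact: bf.1.
have bfT := bounded_measurable_integrable mu (bounded_measurable_comp bf).
rewrite -(@integral_distribution _ _ _ _ _ mu T (EFin \o f) mf bfT).
by apply: eq_measure_integral => B mB _; exact: imu.
Qed.

Lemma mean_birkhoff mu f n : invariant_probability d mu -> bounded_measurable f ->
  J mu (birkhoff d f n) = n%:R * J mu f.
Proof.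
move=> imu bf; elim: n => [|n IHn].
  by rewrite birkhoff0_fun mean_cst mul0r.
have iter_mean : J mu (f \o iter n T) = J mu f.
  elim: n {IHn} => [//|n <-]; rewrite -[RHS]mean_comp//; last exact: bounded_measurable_iter.
  by apply: eq_Rintegral => x _ /=; rewrite -iterSr.
rewrite birkhoffSr_fun (meanD mu (bounded_measurable_birkhoff n bf) (bounded_measurable_iter n bf)).
by rewrite IHn iter_mean -natr1 mulrDl mul1r.
Qed.

Lemma maximizingP f rho : bounded_measurable f ->
  maximizing d f rho <-> invariant_probability d rho /\
    forall mu, invariant_probability d mu -> J mu f <= J rho f.
Proof.
move=> bf; split=> -[irho rhomax]; split=> //.
  move=> mu imu; rewrite -lee_fin -!meanE// rhomax.
  by apply: ereal_sup_ubound; exists mu.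
apply/eqP; rewrite eq_le; apply/andP; split.
  by apply: ereal_sup_ubound; exists rho.
by apply: ge_ereal_sup => _ [mu imu <-]; rewrite !meanE// lee_fin rhomax.
Qed.

End circle_measures.

(** * Orbit measures *)

Section orbit_measures.
Context {R : realType}.
Variable d : nat.
Implicit Types (f g : circle R -> R) (mu nu rho : probability (circle R) R).
Implicit Types (x y : circle R) (B : set (circle R)) (N n : nat).
Local Notation T := (@expanding_map R d).
Local Notation J mu f := (\int[mu]_x f x).

Definition orbit_of y N : set (circle R) := [set x | exists2 i, (i < N)%N & x = iter i T y].

Lemma orbit_ofE y N : (0 < N)%N -> orbit_of y N = [set x | orbit_dist d y N x == 0].
Proof.
move=> N0; apply/seteqP; split=> [_ [i iN ->]|x /= x0]; first by rewrite /= orbit_dist_orbit.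
apply: contrapT => xO.
have : 0 < orbit_dist d y N x.
  apply/bigmin_gtP; split=> // i _; rewrite mdist_gt0.
  by apply/eqP => xi; apply: xO; exists i.
by rewrite (eqP x0) ltxx.
Qed.

Lemma closed_orbit y N : (0 < N)%N -> closed (orbit_of y N).
Proof.
move=> N0; rewrite orbit_ofE// (_ : [set x | _] = orbit_dist d y N @^-1` [set 0]).
  apply: closed_comp; last exact: closed_eq.
  by move=> x _; exact: lipK_continuous (orbit_dist_lipK d y N) x.
by apply/seteqP; split=> x /= /eqP.
Qed.

Lemma measurable_orbit y N : (0 < N)%N -> measurable (orbit_of y N).
Proof.
move=> N0; rewrite -[orbit_of y N]setCK; apply: measurableC; apply: open_measurable_circle.
by apply: closed_openC; exact: closed_orbit.
Qed.

Lemma orbit_periodic y N : (0 < N)%N -> iter N T y = y -> periodic_orbit d (orbit_of y N).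
Proof.
move=> N0 yN; exists y, N; split => //; apply/seteqP; split=> [_ [i iN ->]|_ [k _ <-]].
  by exists i.
exists (k %% N)%N; first by rewrite ltn_mod.
rewrite {1}(divn_eq k N) addnC iterD; congr (iter _ _ _).
by elim: (k %/ N)%N => [//|q IHq]; rewrite mulSn iterD IHq.
Qed.

(** The Birkhoff sum over [N] steps is constant on the orbit and has mean [N * J mu f]. This
    determines [mu] without looking at masses of points, so [N] may be any multiple of the least
    period. *)
Lemma mean_orbit mu y N f : invariant_probability d mu -> bounded_measurable f ->
  (0 < N)%N -> iter N T y = y -> mu (~` orbit_of y N) = 0%E ->
  J mu f = birkhoff d f N y / N%:R.
Proof.
move=> imu bf N0 yN O0; have NR0 : N%:R != 0 :> R by rewrite pnatr_eq0 -lt0n.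
apply: (canRL (mulfK NR0)); rewrite mulrC -(mean_birkhoff N imu bf).
apply: (mean_ae_cst (B := orbit_of y N)) => //.
- exact: bounded_measurable_birkhoff.
- exact: measurable_orbit.
- by move=> _ [i iN ->]; exact: birkhoff_shift.
Qed.

(** The index [n] stands for the period [n.+1], which makes this a probability without side
    condition. *)
Definition orbit_measure y n : set (circle R) -> \bar R :=
  mscale (n.+1%:R^-1)%:nng (msum (fun i => \d_(iter i T y)) n.+1).

HB.instance Definition _ y n := Measure.on (orbit_measure y n).

Lemma orbit_measureE y n B :
  orbit_measure y n B = (birkhoff d \1_B n.+1 y / n.+1%:R)%:E.
Proof.
rewrite /orbit_measure /= /mscale /msum /= mulrC EFinM /birkhoff -sumEFin.
by congr (_ * _)%E.
Qed.

Let orbit_measure_setT y n : orbit_measure y n setT = 1%E.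
Proof.
rewrite orbit_measureE /birkhoff.
under eq_bigr do rewrite indicT.
by rewrite sumr_const card_ord -mulr_natl mulr1 divff.
Qed.

HB.instance Definition _ y n :=
  Measure_isProbability.Build _ _ _ (orbit_measure y n) (orbit_measure_setT y n).

Lemma orbit_measure_invariant y n : iter n.+1 T y = y ->
  invariant_probability d (orbit_measure y n).
Proof.
move=> yn B mB; rewrite /= !orbit_measureE; congr ((_ / _)%:E).
rewrite -[RHS](birkhoff_shift _ 1 yn) /birkhoff.
by apply: eq_bigr => i _; rewrite -iterSr /= !indicE /= /in_mem.
Qed.

Lemma orbit_measureC y n : orbit_measure y n (~` orbit_of y n.+1) = 0%E.
Proof.
rewrite orbit_measureE /birkhoff big1 ?mul0r// => i _.
rewrite indicE; case: (boolP (_ \in _)) => //; rewrite inE => /(_ _)[].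
by exists i.
Qed.

Lemma msupport_orbit_measure y n : msupport (orbit_measure y n) = orbit_of y n.+1.
Proof.
apply/seteqP; split=> [x xs|_ [i iN ->] U [_ Ux]].
  apply: contrapT => xO; suff : (0 < orbit_measure y n (~` orbit_of y n.+1))%E.
    by rewrite orbit_measureC ltxx.
  by apply: xs; split=> //; apply: closed_openC; exact: closed_orbit.
rewrite /= orbit_measureE lte_fin divr_gt0// /birkhoff (bigD1 (Ordinal iN))//=.
rewrite indicE mem_set// ltr_pwDl//.
exact: sumr_ge0.
Qed.

(** The second clause carries uniqueness: an invariant measure attaining the bound lives on the
    orbit, and [mean_orbit] then fixes it. *)
Definition orbit_maximizing f y N := forall mu, invariant_probability d mu ->
  J mu f <= birkhoff d f N y / N%:R /\
  (J mu f = birkhoff d f N y / N%:R -> mu (~` orbit_of y N) = 0%E).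

Lemma orbit_maximizing_unique f y n : bounded_measurable f -> iter n.+1 T y = y ->
  orbit_maximizing f y n.+1 ->
  unique_probability (maximizing d f) (orbit_measure y n).
Proof.
move=> bf yn fmax; have irho := orbit_measure_invariant yn.
have rhoE := mean_orbit irho bf (isT : (0 < n.+1)%N) yn (orbit_measureC y n).
split; first by apply/maximizingP => //; split => // mu /fmax[+ _]; rewrite rhoE.
move=> nu /(maximizingP d _ bf)[inu numax] B mB.
have nuC : nu (~` orbit_of y n.+1) = 0%E.
  have [nule nueq] := fmax nu inu; apply: nueq; apply/eqP.
  by rewrite eq_le nule -rhoE numax.
have b1 := bounded_measurable_indic mB.
rewrite -!mean_indic// (mean_orbit inu b1 _ yn nuC)//.
by rewrite (mean_orbit irho b1 _ yn (orbit_measureC y n)).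
Qed.

Lemma orbit_maximizing_coboundary f u c y N : (0 < N)%N -> iter N T y = y ->
  bounded_measurable f -> bounded_measurable u ->
  orbit_maximizing f y N -> orbit_maximizing (fun x => f x + (u (T x) - u x) + c) y N.
Proof.
move=> N0 yN bf bu fmax mu imu; have [le eq] := fmax mu imu.
have NR0 : N%:R != 0 :> R by rewrite pnatr_eq0 -lt0n.
have bNu := bounded_measurableZ (- 1) bu; have buT := bounded_measurable_comp d bu.
have -> : J mu (fun x => f x + (u (T x) - u x) + c) = J mu f + c.
  transitivity (J mu ((f \+ ((u \o T) \+ (fun x => - 1 * u x))) \+ (fun=> c))).
    by apply: eq_Rintegral => x _ /=; rewrite mulN1r.
  rewrite meanD; last exact: bounded_measurable_cst; last first.
    by apply: bounded_measurableD => //; exact: bounded_measurableD.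
  rewrite meanD//; last exact: bounded_measurableD.
  by rewrite meanD// meanZ// mean_comp// mulN1r subrr addr0 mean_cst.
have -> : birkhoff d (fun x => f x + (u (T x) - u x) + c) N y / N%:R =
    birkhoff d f N y / N%:R + c.
  have -> : birkhoff d (fun x => f x + (u (T x) - u x) + c) N y =
      birkhoff d f N y + (birkhoff d u N (T y) - birkhoff d u N y) + N%:R * c.
    rewrite /birkhoff !big_split /= sumr_const card_ord mulr_natl; congr (_ + _ + _).
    rewrite sumrN; congr (_ - _); apply: eq_bigr => i _.
    by rewrite -iterSr.
  by rewrite (birkhoff_shift u 1 yN) subrr addr0 mulrDl mulrAC divff ?mul1r.
by rewrite lerD2r; split=> // /addIr.
Qed.

End orbit_measures.

(** * Locked perturbations *)

Section locked_perturbation.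
Context {R : realType}.
Variable d : nat.
Hypothesis d2 : (2 <= d)%N.
Implicit Types (A b f g h phi : circle R -> R) (K L D eps delta : R) (y p : circle R).
Local Notation T := (@expanding_map R d).
Local Notation J mu f := (\int[mu]_x f x).

Lemma locked_orbit_maximizing phi K eps p : lipK K phi -> (forall x, 0 <= phi x) ->
  (forall i, phi (iter i T p) = 0) -> 0 < eps ->
  exists y N delta, [/\ (0 < N)%N, iter N T y = y, 0 < delta &
    forall h, lipK 3 h -> (forall x, `|h x| <= delta) ->
      orbit_maximizing d (fun x => h x - phi x - eps * orbit_dist d y N x) y N].
Proof.
move=> phiK phi0 phip eps0; have K0 := lipK_ge0 phiK.
(* Half of the penalty locks the orbit; the other half makes every maximizing measure live on it. *)
pose e := eps / 2; have e0 : 0 < e by rewrite divr_gt0.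
have d0 : 0 < d%:R :> R by rewrite ltr0n (leq_trans _ d2).
pose K' := 3 + K + e; have K'0 : 0 < K' by rewrite /K'; lra.
(* The hypothesis [CD] of the locking lemma reduces to [N * kappa * Q <= e * D / (2 * d)], where
   [N * kappa = S + 2 * N * delta]. [L], fixed before the orbit, and [delta], fixed after it, each
   take half of the right-hand side. *)
pose Q := 2 + 2 * K' / e; have Q0 : 0 < Q by rewrite addr_gt0// divr_gt0// mulr_gt0.
pose L := 4 * d%:R * Q / e; have L0 : 0 < L by rewrite divr_gt0// !mulr_gt0.
have [y [N [D [N0 yN /andP[D0 D1] sepD LS]]]] := zero_orbit_separated d2 phiK phi0 phip L0.
have NR0 : 0 < N%:R :> R by rewrite ltr0n.
have N1 : 1 <= N%:R :> R by rewrite ler1n.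
pose delta := e * D / (8 * d%:R * N%:R * Q).
have delta0 : 0 < delta by rewrite divr_gt0 ?mulr_gt0.
exists y, N, delta; split => // h hK hdelta.
set S := birkhoff d phi N y in LS; have S0 : 0 <= S by exact: sumr_ge0.
pose dO := orbit_dist d y N.
have dOK : lipK 1 dO by exact: orbit_dist_lipK.
pose G x := h x - phi x - e * dO x.
have GK : lipK K' G.
  have -> : K' = 3 + K + `|e| * 1 by rewrite mulr1 gtr0_norm.
  exact: lipKB (lipKB hK phiK) (lipKZ e dOK).
have bG : bounded_measurable G by exact: bounded_measurable_lipK GK.
have birkhoffG c : birkhoff d (fun x => h x - phi x - c * dO x) N y = birkhoff d h N y - S.
  rewrite /S /birkhoff -sumrB; apply: eq_bigr => i _.
  by rewrite /dO orbit_dist_orbit// mulr0 subr0.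
pose gbar := birkhoff d G N y / N%:R.
pose psi x := G x - gbar.
have psiK : lipK K' psi by rewrite -[K']addr0; exact: lipKB GK (lipK_cst gbar).
(* One [delta] bounds [h], the other its average along the orbit, which enters [gbar]. *)
pose kappa := S / N%:R + 2 * delta.
have kappa0 : 0 <= kappa.
  by apply: addr_ge0; [rewrite divr_ge0|rewrite mulr_ge0// ltW].
have psiN : birkhoff d psi N y = 0.
  have -> : birkhoff d psi N y = birkhoff d G N y - gbar *+ N.
    by rewrite -[N in _ *+ N]card_ord -sumr_const -sumrB.
  by rewrite -mulr_natr /gbar divfK ?subrr// gt_eqF.
have gbarE : - gbar <= S / N%:R + delta.
  rewrite /gbar -mulNr ler_pdivrMr// mulrDl divfK ?gt_eqF// birkhoffG opprB lerD2l.
  rewrite /birkhoff -sumrN mulr_natr -[X in _ *+ X]card_ord -sumr_const.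
  by apply: ler_sum => i _; rewrite (le_trans (ler_norm _))// normrN.
have psi_le x : psi x <= kappa - e * dO x.
  have := phi0 x; have := le_trans (ler_norm _) (hdelta x).
  rewrite /psi /G /kappa; lra.
have kappaN : N%:R * kappa = S + 2 * N%:R * delta.
  by rewrite /kappa mulrDr mulrCA divff ?gt_eqF// mulr1; ring.
have CD : N%:R * kappa + 2 * K' * (kappa / e) + kappa <= e * (D / (2 * d%:R)).
  have kN : kappa <= N%:R * kappa by rewrite ler_peMl.
  apply: (@le_trans _ _ (N%:R * kappa * Q)).
    have : kappa / e * (2 * K') <= N%:R * kappa / e * (2 * K').
      by rewrite ler_pM2r ?mulr_gt0// ler_pM2r ?invr_gt0.
    rewrite /Q; lra.
  have SQ : S * Q <= e * D / (4 * d%:R).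
    move: LS; rewrite /L mulrAC ler_pdivrMr// => LS.
    rewrite ler_pdivlMr ?mulr_gt0//; lra.
  have -> : e * (D / (2 * d%:R)) = e * D / (4 * d%:R) + 2 * N%:R * delta * Q.
    by rewrite /delta; field; rewrite !gt_eqF.
  by rewrite kappaN mulrDl lerD2r.
move=> mu imu.
(* The mean of the [n]-step Birkhoff sum is [n * J mu psi], and [birkhoff_locked] bounds it
   independently of [n]. *)
have Jpsi : J mu psi <= 0.
  have bpsi := bounded_measurable_lipK psiK.
  rewrite leNgt; apply/negP => J0.
  pose C := N%:R * kappa + 2 * K' * (kappa / e).
  have JC n : n%:R * J mu psi <= C.
    rewrite -(mean_birkhoff n imu bpsi) -(mean_cst mu C).
    apply: mean_le; [exact: bounded_measurable_birkhoff|exact: bounded_measurable_cst|].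
    move=> x; exact: (birkhoff_locked d2 psiK e0 kappa0 N0 yN D1 sepD psiN psi_le CD).
  have := JC (Num.bound (C / J mu psi)); rewrite -ler_pdivlMr// leNgt.
  by rewrite archi_boundP// divr_ge0 ?(ltW J0)//; have := JC 0%N; rewrite mul0r.
have bdO : bounded_measurable dO := bounded_measurable_lipK dOK.
have JG : J mu G <= gbar.
  have -> : J mu G = J mu psi + gbar.
    rewrite -[X in _ + X](mean_cst mu) -meanD; last exact: bounded_measurable_cst.
      by apply: eq_Rintegral => x _; rewrite /psi /= subrK.
    exact: bounded_measurable_lipK psiK.
  by rewrite gerDr.
have JE : J mu (fun x => h x - phi x - eps * dO x) = J mu G - e * J mu dO.
  rewrite -mulNr -meanZ// -meanD//; last exact: bounded_measurableZ.
  by apply: eq_Rintegral => x _; rewrite /G /= /e; field.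
have JdO0 : 0 <= J mu dO by apply: Rintegral_ge0 => x _; exact: orbit_dist_ge0.
rewrite JE birkhoffG -(birkhoffG e) -[_ / _]/gbar; split.
  by rewrite lerBlDr (le_trans JG)// lerDl mulr_ge0// ltW.
move=> JEq; have J0 : J mu dO = 0.
  apply/eqP; rewrite eq_le JdO0 andbT -(pmulr_rle0 _ e0); lra.
have := mean_eq0 bdO (orbit_dist_ge0 d y N) J0.
by rewrite orbit_ofE//; congr (mu _ = _); apply/seteqP; split=> x /= /negP.
Qed.

End locked_perturbation.

(** * Stability of the selection and the Lipschitz case *)

Section robust_selection.
Context {R : realType}.
Variable d : nat.
Hypothesis d2 : (2 <= d)%N.
Implicit Types (A B b f g h : circle R -> R) (K L eps delta lam : R) (y : circle R).
Local Notation T := (@expanding_map R d).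

Lemma eq_orbit_maximizing f g y N : f =1 g ->
  orbit_maximizing d f y N -> orbit_maximizing d g y N.
Proof. by move=> /funext ->. Qed.

(* The discounted subaction [b] makes [A] cohomologous to
   [(1 - lam) * b - phi] with [phi >= 0] vanishing along an orbit, and for [lam]
   close to 1 the term [(1 - lam) * b] is, up to a constant, a small Lipschitz
   function; the perturbation [g] removes it. *)
Lemma lockable A K eps : lipK K A -> 0 < eps <= 1 ->
  exists y N g delta, [/\ (0 < N)%N /\ iter N T y = y, 0 < delta, lipK eps g,
    forall x, `|g x| <= eps &
    forall h, lipK 3 h -> (forall x, `|h x| <= delta) ->
      orbit_maximizing d (fun x => A x + g x + h x) y N].
Proof.
move=> AK /andP[eps0 eps1]; have K0 := lipK_ge0 AK.
(* [1 - c] is the discount. The term [c * (b - b 0)] uses half of the size allowed for [g], the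
   distance to the orbit the other half. *)
pose c := eps / (2 * (K + 1)).
have K1 : 0 < K + 1 by rewrite ltr_wpDl.
have c0 : 0 < c by rewrite divr_gt0// mulr_gt0.
have cK : c * K <= eps / 2.
  rewrite /c invfM mulrA mulrAC ler_pdivrMr// ler_wpM2l ?lerDl//.
  by rewrite divr_ge0// ltW.
have c1 : c < 1.
  rewrite ltr_pdivrMr ?mulr_gt0// mul1r; lra.
have [b bE] : exists b, calibrated_subaction d (1 - c) A b.
  by apply: (calibrated_exists d2 _ AK); apply/andP; split; lra.
have bK : lipK K b by apply: (calibrated_lipK d2 _ AK bE); apply/andP; split; lra.
have [p pE] := calibrated_zero_orbit AK bK bE.
have e0 : 0 < eps / 2 by rewrite divr_gt0.
have [y [N [delta [N0 yN delta0 lock]]]] := locked_orbit_maximizing d2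
  (calibrated_defect_lipK d (1 - c) AK bK) (fun x => calibrated_ge x bE) pE e0.
pose dO := orbit_dist d y N.
have dOK : lipK 1 dO by exact: orbit_dist_lipK.
pose g x := - (c * (b x - b 0)) - eps / 2 * dO x.
exists y, N, g, delta; split => //.
- have := lipKB (lipKN (lipKZ c (lipKB bK (lipK_cst (b 0))))) (lipKZ (eps / 2) dOK).
  apply: lipK_le; rewrite addr0 mulr1 !gtr0_norm//; lra.
- move=> x; have := lipK_ub x 0 bK; have := orbit_dist_ge0 d y N x.
  have := orbit_dist_le1 d y N x; rewrite /g -/dO => dO1 dO0 bx.
  have cb : `|c * (b x - b 0)| <= eps / 2.
    by rewrite normrM gtr0_norm// (le_trans _ cK)// ler_pM2l.
  have dOe : `|eps / 2 * dO x| <= eps / 2.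
    by rewrite normrM gtr0_norm// ger0_norm// ler_piMr// ltW.
  rewrite (le_trans (ler_normB _ _))// normrN; lra.
move=> h hK hd; have bh := bounded_measurable_lipK hK.
have := orbit_maximizing_coboundary (c * b 0) N0 yN _ (bounded_measurable_lipK bK) (lock h hK hd).
have bF : bounded_measurable (fun x => h x - (b (T x) - (1 - c) * b x - A x) - eps / 2 * dO x).
  have phiK := calibrated_defect_lipK d (1 - c) AK bK.
  exact: bounded_measurable_lipK (lipKB (lipKB hK phiK) (lipKZ (eps / 2) dOK)).
move=> /(_ bF); apply: eq_orbit_maximizing => x.
by rewrite /g -/dO; ring.
Qed.

(** Adding the coboundary of [b] turns [B - b \o T + lam * b] into [B + (lam - 1) * b], that is, up
    to a constant, [B + h] with [h = (lam - 1) * (b - b 0)]. Both the size and the Lipschitz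
    constant of [h] are at most [(1 - lam) * K], so one [delta] serves all [lam] near 1. *)
Lemma robust_selects B K y N delta : lipK K B -> (0 < N)%N -> iter N T y = y ->
  0 < delta ->
  (forall h, lipK 1 h -> (forall x, `|h x| <= delta) ->
    orbit_maximizing d (B \+ h) y N) ->
  selects_periodic_orbit d B.
Proof.
move=> BK N0 yN delta0 lock; have K0 := lipK_ge0 BK.
case: N N0 yN lock => [//|n] N0 yn lock.
have uniq h c b : lipK 1 h -> (forall x, `|h x| <= delta) -> lipK K b ->
    unique_probability (maximizing d (fun x => (B \+ h) x + (b (T x) - b x) + c))
      (orbit_measure d y n).
  move=> hK hd bK; have bBh : bounded_measurable (B \+ h).
    exact: bounded_measurable_lipK (lipKD BK hK).
  have bb := bounded_measurable_lipK bK.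
  apply: orbit_maximizing_unique => //; last first.
    by apply: orbit_maximizing_coboundary => //; exact: lock.
  apply: bounded_measurableD; last exact: bounded_measurable_cst.
  apply: bounded_measurableD => //; rewrite (_ : (fun x => _) = (b \o T) \- b)//.
  exact: bounded_measurable_lipK (lipKB (lipK_comp_map d bK) bK).
have uniqB : unique_probability (maximizing d B) (orbit_measure d y n).
  have lip0 L : 0 <= L -> lipK L (fun=> 0 : R) by move=> L0; exact: lipK_le L0 (lipK_cst 0).
  have := uniq (fun=> 0) 0 (fun=> 0) (lip0 1 ler01) _ (lip0 K K0).
  have E : (fun x => B x + 0 + (0 - 0) + 0) = B.
    by apply/funext => x; rewrite subrr !addr0.
  by rewrite /= E; apply => x; rewrite normr0 ltW.
pose e := Num.min delta 1 / (K + 1).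
have m0 : 0 < Num.min delta 1 by rewrite lt_min delta0 ltr01.
have K1 : 0 < K + 1 by rewrite ltr_wpDl.
have e0 : 0 < e by rewrite divr_gt0.
have eK : e * K <= Num.min delta 1.
  by rewrite /e mulrAC ler_pdivrMr// ler_wpM2l ?(ltW m0)// lerDl.
(* Keeps [lam] positive, as the existence of calibrated subactions requires. *)
have e1 : e <= 1.
  by rewrite ler_pdivrMr// mul1r (le_trans (_ : _ <= 1)) ?ge_min ?lexx ?orbT// lerDr.
exists (orbit_of d y n.+1); split; first exact: orbit_periodic.
  by exists (orbit_measure d y n) => //; exact: msupport_orbit_measure.
exists e => // lam /andP[laml lam1]; exists (orbit_measure d y n); last first.
  by rewrite msupport_orbit_measure.
rewrite /lambda_maximizing; case: eqVneq => [//|lamN1].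
have {lamN1}lam1 : lam < 1 by rewrite lt_neqAle lamN1.
have uniqb b : calibrated_subaction d lam B b ->
    unique_probability (maximizing d (fun x => B x - b (T x) + lam * b x)) (orbit_measure d y n).
  move=> bE; have bK : lipK K b.
    by apply: (calibrated_lipK d2 _ BK bE); apply/andP; split; lra.
  pose h x := (lam - 1) * (b x - b 0).
  have lamK : (1 - lam) * K <= Num.min delta 1.
    by rewrite (le_trans _ eK)// ler_wpM2r//; lra.
  have hK : lipK 1 h.
    have := lipKZ (lam - 1) (lipKB bK (lipK_cst (b 0))).
    apply: lipK_le; rewrite addr0 ltr0_norm ?subr_lt0// opprB.
    by rewrite (le_trans lamK)// ge_min lexx orbT.
  have hd x : `|h x| <= delta.
    rewrite normrM ltr0_norm ?subr_lt0// opprB.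
    rewrite (le_trans (ler_wpM2l _ (lipK_ub x 0 bK)))//; first lra.
    by rewrite (le_trans lamK)// ge_min lexx.
  have := uniq h ((lam - 1) * b 0) (\- b) hK hd (lipKN bK).
  congr (unique_probability (maximizing d _) _).
  by apply/funext => x /=; rewrite /h; ring.
have [b bE] : exists b, calibrated_subaction d lam B b.
  by apply: (calibrated_exists d2 _ BK); apply/andP; split; lra.
split; first by exists b => //; exact: (uniqb b bE).1.
by move=> nu [b' b'E numax]; exact: (uniqb b' b'E).2.
Qed.

(** The interior of [P] is itself open and dense, so a constant sequence of sets suffices. *)
Lemma generic_of_robust (E : metricType R) (P : set E) :
  (forall (A : E) (eta : R), 0 < eta -> exists A' : E, mdist A A' < eta /\
    exists2 delta, 0 < delta & forall B : E, mdist A' B < delta -> P B) ->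
  generic P.
Proof.
move=> robust; exists (fun=> P°); split; last first.
  by move=> A /(_ 0%N Logic.I) /interior_subset.
move=> _; split; first exact: open_interior.
move=> O [A OA] oO.
have /nbhs_ballP[eta /= eta0 etaO] : nbhs A O by exact: open_nbhs_nbhs.
have [A' [AA' [delta delta0 deltaP]]] := robust A eta eta0.
exists A'; split; first by apply: etaO; rewrite ballEmdist.
by apply/nbhs_ballP; exists delta => // B; rewrite ballEmdist; exact: deltaP.
Qed.

Lemma lip_norm_le g eps : 0 <= eps -> lipK eps g -> (forall x, `|g x| <= eps) ->
  lip_norm g <= eps + eps.
Proof.
move=> eps0 gK ge; apply: lerD; first exact: sup_norm_le.
apply: sup_norm_le => // -[x x'] /= xx'; rewrite /diff_quotient /= normrM normfV.
by rewrite (ger0_norm (mdist_ge0 _ _)) ler_pdivrMr ?mdist_gt0.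
Qed.

Lemma le_lip_norm h : circle_lipschitz h ->
  lipK (lip_norm h) h /\ forall x, `|h x| <= lip_norm h.
Proof.
move=> hL; have b1 := circle_lipschitz_bounded hL; have b2 := diff_quotient_bounded hL.
split=> [x x'|x]; last by rewrite (le_trans (sup_norm_ub b1 _))// lerDl sup_norm_ge0.
have [->|xx'] := eqVneq x x'; first by rewrite subrr normr0 mdistxx mulr0.
have := sup_norm_ub b2 (xx' : off_diagonal (x, x')).
rewrite /diff_quotient /= normrM normfV (ger0_norm (mdist_ge0 _ _)).
rewrite ler_pdivrMr ?mdist_gt0// => /le_trans; apply.
by rewrite ler_wpM2r ?mdist_ge0// lerDr sup_norm_ge0.
Qed.

Lemma generic_lip_potential :
  generic [set A : lip_potential R | selects_periodic_orbit d A].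
Proof.
apply: generic_of_robust => A eta eta0.
have [K0 A0] := lip_funP A; have AK : lipK K0 A by [].
pose eps := Num.min 1 (eta / 4).
have eps0 : 0 < eps by rewrite lt_min ltr01 divr_gt0.
have eps1 : eps <= 1 by rewrite ge_min lexx.
have eps_eta : eps <= eta / 4 by rewrite ge_min lexx orbT.
have [|y [N [g [delta [[N0 yN] delta0 gK ge lock]]]]] := lockable AK (eps := eps).
  by rewrite eps0.
have AgL : circle_lipschitz (A \+ g) by exists (K0 + eps); exact: lipKD.
exists (LipPotential AgL); split.
  rewrite -[mdist _ _]/(lip_norm (A \- (A \+ g))) (_ : _ \- _ = \- g); last first.
    by apply/funext => x /=; rewrite opprD addrA subrr add0r.
  rewrite (le_lt_trans (lip_norm_le (ltW eps0) (lipKN gK) _))//; last lra.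
  by move=> x; rewrite normrN.
exists (Num.min 1 (delta / 2)); first by rewrite lt_min ltr01 divr_gt0.
move=> B; rewrite -[mdist _ _]/(lip_norm ((A \+ g) \- B)) lt_min => /andP[B1 Bd].
have [hK hd] := le_lip_norm (circle_lipschitzB AgL (lip_funP B)).
have [KB BK] := lip_funP B.
apply: (robust_selects (K := KB) BK N0 yN (delta := delta / 2)); first by rewrite divr_gt0.
move=> h h1 hdelta.
have := lock (h \- ((A \+ g) \- B)) _ _.
have E : (fun x => A x + g x + (h \- ((A \+ g) \- B)) x) = B \+ h.
  by apply/funext => x /=; ring.
rewrite E; apply.
  by apply: lipK_le (lipKB h1 hK); lra.
move=> x; rewrite (le_trans (ler_normB _ _))//.
have := hdelta x; have := hd x; rewrite /=; lra.
Qed.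

End robust_selection.

(** * Smoothing *)

Section C1_smoothing.
Context {R : realType}.
Implicit Types (F : R -> R) (f g h w : circle R -> R) (r s t : R).

Lemma antiderivative F : continuous F ->
  exists P : R -> R, forall x : R, is_derive x (1 : R) P (F x).
Proof.
move=> cF; pose mu := @lebesgue_measure R.
pose P x := if 0 <= x then \int[mu]_(t in `]0, x]) F t else - \int[mu]_(t in `]x, 0]) F t.
(* With [a] below both [x] and 0, [P] agrees near [x] with [G - G 0], and the fundamental theorem
   applies to [G]. *)
exists P => x; pose a := Num.min x 0 - 1; pose u := Num.max x 0 + 1.
have ax : a < x by rewrite ltrBlDr ltr_pwDr// ge_min lexx.
have a0 : a < 0 by rewrite ltrBlDr ltr_pwDr// ge_min lexx orbT.
have xu : x < u by rewrite ltr_pwDr// le_max lexx.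
have u0 : 0 < u by rewrite ltr_pwDr// le_max lexx orbT.
pose G z := \int[mu]_(t in `[a, z]) F t.
have int z : mu.-integrable `[a, z] (EFin \o F).
  apply: continuous_compact_integrable; first exact: segment_compact.
  exact: continuous_subspaceT.
have PG z : a < z -> P z = G z - G 0.
  move=> az; rewrite /P; case: ifPn => [z0|].
    by rewrite /G Rintegral_itvB// bnd_simp// ltW.
  rewrite -ltNge => z0; rewrite -[RHS]opprB /G Rintegral_itvB//.
    by rewrite bnd_simp ltW.
  by rewrite bnd_simp ltW.
have [dG G'] := continuous_FTC1_closed xu (int u) ax (cF x).
have isG : is_derive x (1 : R) (G - cst (G 0)) (F x).
  have : is_derive x (1 : R) G (F x) by apply: (DeriveDef dG); rewrite -derive1E.
  by move=> ?; rewrite -[F x]subr0; exact: is_deriveB.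
apply: near_eq_is_derive isG; near=> z; rewrite PG//; near: z.
exact: lt_nbhsr.
Unshelve. all: by end_near. Qed.

Lemma bounded_derive_lipschitz (H dH : R -> R) M :
  (forall x : R, is_derive x (1 : R) H (dH x)) -> (forall x, `|dH x| <= M) ->
  forall a b, `|H b - H a| <= M * `|b - a|.
Proof.
move=> isH dHM a b; wlog ab : a b / a <= b.
  move=> wlg; have [/wlg//|/ltW/wlg] := leP a b.
  by rewrite distrC (distrC a).
have cH : {within `[a, b], continuous H}.
  apply: continuous_subspaceT => x; apply: differentiable_continuous.
  by apply/derivable1_diffP; have [] := isH x.
have [c _ ->] := MVT_segment ab (fun x _ => isH x) cH.
by rewrite normrM ler_wpM2r.
Qed.

Lemma C1_lipK h M : circle_C1 h ->
  (forall r, `|derive1 (h \o @to_circle R) r| <= M) -> lipK M h.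
Proof.
move=> [dh _] hM x y; have [t -> <-] := mdist_lift x y; have [r <-] := to_circle_surj x.
have isH (z : R) : is_derive z (1 : R) (h \o @to_circle R) (derive1 (h \o @to_circle R) z).
  by apply: DeriveDef; [exact: dh|rewrite derive1E].
have := bounded_derive_lipschitz isH hM (r + t) r.
by rewrite /= to_circleD opprD addrA subrr add0r normrN.
Qed.

Lemma circle_C1_lipK h : circle_C1 h -> exists K, lipK K h.
Proof.
move=> hC; have [M hM] := circle_C1_derive_bounded hC.
by exists M; apply: C1_lipK => // r; exact: hM.
Qed.

(* [w] is the average of [f] over an arc of length [s]. *)
Lemma C1_smoothing f eps delta : lipK eps f -> (forall x, `|f x| <= eps) ->
  0 < delta -> exists w, [/\ circle_C1 w, forall x, `|w x| <= eps,
    forall r, `|derive1 (w \o @to_circle R) r| <= eps &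
    forall x, `|w x - f x| <= delta].
Proof.
move=> fK fe delta0; have eps0 := lipK_ge0 fK.
have eps1 : 0 < eps + 1 by rewrite ltr_wpDl.
pose s := delta / (eps + 1); have s0 : 0 < s by rewrite divr_gt0.
have sd : eps * s <= delta.
  by rewrite /s mulrA ler_pdivrMr// mulrC ler_pM2l// lerDl.
pose F := f \o @to_circle R.
have FK a b : `|F a - F b| <= eps * `|a - b|.
  rewrite (le_trans (fK _ _))// ler_wpM2l// -(subrK a b) [b - a + a]addrC to_circleD.
  by rewrite distrC (le_trans (mdist_shift_le _ _))// addrAC subrr add0r.
have cF : continuous F.
  move=> x; apply: continuous_comp; first exact: to_circle_continuous.
  exact: lipK_continuous fK _.
have [P isP] := antiderivative cF.
have isPs t (x : R) : is_derive x (1 : R) (P \o shift t) (F (x + t)).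
  have i1 := isP (x + t); have i2 : is_derive x (1 : R) (shift t) 1 by exact: is_derive_shift.
  by rewrite -[F _]mulr1; exact: is_derive1_comp.
pose W x := (P (x + s) - P x) / s.
have isW (x : R) : is_derive x (1 : R) W ((F (x + s) - F x) / s).
  have i1 := isPs s x; have i2 := isP x.
  have i3 : is_derive x (1 : R) ((P \o shift s) - P) (F (x + s) - F x) by exact: is_deriveB.
  have := @is_deriveZ _ _ _ _ (s^-1) _ _ _ i3.
  rewrite /GRing.scale /= mulrC; congr is_derive.
  by apply/funext => z; rewrite /W mulrC.
(* [P] need not be periodic, but [P (z + 1) - P z] is constant since [F] is periodic, and the
   constant cancels in [W]. *)
have W1 x : W (x + 1) = W x.
  pose D z := P (z + 1) - P z.
  have isD (z : R) : is_derive z (1 : R) ((P \o shift 1) - P) 0.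
    have i1 := isPs 1 z; have i2 := isP z.
    have -> : 0 = F (z + 1) - F z :> R by rewrite /F /= (to_circleDz z 1) subrr.
    exact: is_deriveB.
  have := is_derive_0_is_cst (x + s) x isD.
  rewrite /W (addrAC x) /= => h; congr (_ / _); move: h.
  rewrite -[LHS]/(P (x + s + 1) - P (x + s)) -[RHS]/(P (x + 1) - P x); lra.
have WnN x n : W (x + n%:R) = W x.
  by elim: n => [|n IHn]; [rewrite addr0|rewrite -natr1 addrA W1].
have Wz x (n : int) : W (x + n%:~R) = W x.
  case: n => n; first exact: WnN.
  by rewrite NegzE mulrNz -[RHS](WnN _ n.+1) [in RHS]addrC -[LHS](WnN _ n.+1) subrK addrC.
(* By the mean value theorem an average is a value of [F] nearby; this yields both the sup bound and
   the closeness to [f]. *)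
have WF x : exists2 c, `|c - x| <= s & W x = F c.
  have xs : x <= x + s by rewrite lerDl ltW.
  have cP : {within `[x, x + s], continuous P}.
    apply: continuous_subspaceT => z; apply: differentiable_continuous.
    by apply/derivable1_diffP; have [] := isP z.
  have [c] := MVT_segment xs (fun z _ => isP z) cP.
  rewrite in_itv /= => /andP[xc cs]; rewrite addrAC subrr add0r => h.
  exists c; first by rewrite ger0_norm ?subr_ge0// lerBlDl.
  by rewrite /W h mulfK// gt_eqF.
pose w x := W (lift01 x).
have wW : w \o @to_circle R = W.
  apply/funext => r; rewrite /w /=.
  have /eqP := lift01K (to_circle r); rewrite to_circle_eq => /intrP[n rn].
  by rewrite -(Wz r n) -rn addrC subrK.
have dW (r : R) : derive1 W r = (F (r + s) - F r) / s by rewrite derive1E; have [] := isW r.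
have wF x : exists2 c, `|c - lift01 x| <= s & w x = F c by exact: WF.
exists w; split.
- split; rewrite wW; first by move=> r; have [] := isW r.
  rewrite (_ : derive1 W = fun r => (F (r + s) - F r) / s); last exact/funext.
  have cFs : continuous (F \o shift s).
    move=> r; apply: continuous_comp; last exact: cF.
    by apply: cvgD; [exact: cvg_id|exact: cvg_cst].
  by move=> r; apply: cvgMl; apply: cvgB; [exact: cFs|exact: cF].
- by move=> x; have [c _ ->] := wF x; exact: fe.
- move=> r; rewrite wW dW normrM normfV (gtr0_norm s0) ler_pdivrMr//.
  by rewrite (le_trans (FK _ _))// addrAC subrr add0r gtr0_norm.
- move=> x; have [c cx ->] := wF x; rewrite -{1}(lift01K x) -[f _]/(F _).
  by rewrite (le_trans (FK _ _))// (le_trans _ sd)// ler_wpM2l.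
Qed.

End C1_smoothing.

(** * The case of $C^1$ potentials *)

Section generic_C1.
Context {R : realType}.
Variable d : nat.
Hypothesis d2 : (2 <= d)%N.

Lemma le_C1_norm (h : circle R -> R) : circle_C1 h ->
  lipK (C1_norm h) h /\ forall x, `|h x| <= C1_norm h.
Proof.
move=> hC; have b1 := circle_C1_bounded hC; have b2 := circle_C1_derive_bounded hC.
split=> [|x]; last by rewrite (le_trans (sup_norm_ub b1 _))// lerDl sup_norm_ge0.
apply: C1_lipK => // r.
by rewrite (le_trans (sup_norm_ub b2 _))// lerDr sup_norm_ge0.
Qed.

(** The Lipschitz perturbation [g] is replaced by [- w] with [w] of class $C^1$ and uniformly close
    to [- g]. The error [w + g] is small in the sup norm only, which the locking tolerates. *)
Lemma generic_C1_potential :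
  generic [set A : C1_potential R | selects_periodic_orbit d A].
Proof.
apply: generic_of_robust => A eta eta0.
have [K AK] := circle_C1_lipK (C1_funP A).
(* The bound [2^-1] makes the Lipschitz constants of [h], of the $C^1$ perturbation and of [w + g]
   add up to at most [1 + 1 + 2 * eps <= 3], the constant in [lockable]. *)
pose eps := Num.min 2^-1 (eta / 4).
have eps0 : 0 < eps by rewrite lt_min invr_gt0 ltr0n divr_gt0.
have eps1 : eps <= 2^-1 by rewrite ge_min lexx.
have eps_eta : eps <= eta / 4 by rewrite ge_min lexx orbT.
have [|y [N [g [delta [[N0 yN] delta0 gK ge lock]]]]] := lockable d2 AK (eps := eps).
  by rewrite eps0/=; lra.
have d30 : 0 < delta / 3 by rewrite divr_gt0.
have gNe x : `|(\- g) x| <= eps by rewrite normrN.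
have [w [wC we dwe wg]] := C1_smoothing (lipKN gK) gNe d30.
have wK := C1_lipK wC dwe.
have AwC := circle_C1B (C1_funP A) wC.
exists (C1Potential AwC); split.
  rewrite -[mdist _ _]/(C1_norm (A \- (A \- w))) (_ : _ \- _ = w); last first.
    by apply/funext => x /=; rewrite opprB addrC subrK.
  apply: (@le_lt_trans _ _ (eps + eps)); last lra.
  by apply: lerD; apply: sup_norm_le => // *; exact: ltW.
exists (Num.min 1 (delta / 3)); first by rewrite lt_min ltr01 d30.
move=> B; rewrite -[mdist _ _]/(C1_norm ((A \- w) \- B)) lt_min => /andP[B1 Bd].
have [hK hd] := le_C1_norm (circle_C1B AwC (C1_funP B)).
have [KB BK] := circle_C1_lipK (C1_funP B).
apply: (robust_selects d2 BK N0 yN d30) => h h1 hdelta.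
have := lock ((h \- ((A \- w) \- B)) \- (w \+ g)) _ _.
have E : (fun x => A x + g x + ((h \- ((A \- w) \- B)) \- (w \+ g)) x) = B \+ h.
  by apply/funext => x /=; ring.
rewrite E; apply.
  by apply: lipK_le (lipKB (lipKB h1 hK) (lipKD wK gK)); lra.
move=> x; rewrite (le_trans (ler_normB _ _))// -[delta](_ : delta / 3 + delta / 3 + delta / 3 = _).
  rewrite lerD//; last by have := wg x; rewrite /= opprK.
  by rewrite (le_trans (ler_normB _ _))// lerD// (le_trans (hd x))// ltW.
by field.
Qed.

End generic_C1.

(** * Weak limits *)

Section weak_limits.
Context {R : realType}.
Implicit Types (f A b : circle R -> R) (mu nu rho : probability (circle R) R).
Implicit Types (x y : circle R) (U B : set (circle R)).
Local Notation J mu f := (\int[mu]_x f x).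

(* [U] is the increasing union of the sets of points at distance at least
   [k.+1^-1] from the complement of [U]. *)
Lemma open_le_of_means mu nu U : (forall f, continuous f -> J mu f = J nu f) ->
  open U -> (mu U <= nu U)%E.
Proof.
move=> munu oU; have [->|UT] := eqVneq U setT; first by rewrite !probability_setT.
have [c0 Uc0] : ~` U !=set0.
  by apply/set0P; apply: contra UT => /eqP h; rewrite -[U]setCK h setC0.
pose S x := [set mdist x c | c in ~` U].
have Slb x : has_lbound (S x) by exists 0 => _ [c _ <-]; exact: mdist_ge0.
have S0 x : S x !=set0 by exists (mdist x c0), c0.
pose D x := inf (S x).
have D0 x : 0 <= D x by apply: lb_le_inf => // _ [c _ <-]; exact: mdist_ge0.
have DK : lipK 1 D.
  have h x x' : D x - D x' <= mdist x x'.
    rewrite lerBlDr -lerBlDl; apply: lb_le_inf => // _ [c Uc <-].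
    rewrite lerBlDl (@le_trans _ _ (mdist x c))//; last exact: metric_triangle.
    by apply: ge_inf => //; exists c.
  move=> x x'; rewrite mul1r ler_norml h andbT lerNl opprB metric_sym.
  exact: h.
have DU x : ~ U x -> D x = 0.
  move=> Ux; apply/eqP; rewrite eq_le D0 andbT.
  by apply: ge_inf => //; exists x => //; exact: mdistxx.
have UD x : U x -> 0 < D x.
  move=> Ux; have /nbhs_ballP[e /= e0 eU] : nbhs x U by exact: open_nbhs_nbhs.
  rewrite (lt_le_trans e0)//; apply: lb_le_inf => // _ [c Uc <-].
  by rewrite leNgt; apply/negP => xc; apply: Uc; apply: eU; rewrite ballEmdist.
pose F k := [set x | k.+1%:R^-1 <= D x].
have mF k : measurable (F k).
  rewrite -[F k]setCK; apply: measurableC; apply: open_measurable_circle.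
  apply: closed_openC; apply: (@closed_comp _ _ D [set t | k.+1%:R^-1 <= t]).
    by move=> x _; exact: lipK_continuous DK x.
  exact: closed_ge.
have UF : \bigcup_k F k = U.
  apply/seteqP; split=> [x [k _ /= kx]|x /UD Dx].
    by apply: contrapT => /DU Dx0; move: kx; rewrite /F /= Dx0 leNgt invr_gt0 ltr0n.
  have [k kD] : exists k, k.+1%:R^-1 < D x.
    exists (Num.bound (D x)^-1); rewrite invf_plt ?posrE ?ltr0n//.
    rewrite (lt_trans (archi_boundP _)) ?invr_ge0 ?D0// ltr_nat//.
  by exists k => //; exact: ltW.
have ndF : {homo F : n m / (n <= m)%N >-> (n <= m)%O}.
  move=> n m nm; apply/subsetPset => x /=; apply: le_trans.
  by rewrite lef_pV2 ?posrE ?ltr0n// ler_nat ltnS.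
have := @nondecreasing_cvg_mu _ _ _ mu F mF _ ndF.
rewrite UF => /(_ (open_measurable_circle oU)); apply: cvge_le; apply: nearW => k /=.
(* A continuous function between the indicators of [F k] and of [U]. *)
pose f x := Num.min 1 (k.+1%:R * D x).
have fK : lipK (k.+1%:R * 1) f.
  have gK := lipKZ k.+1%:R DK; rewrite ger0_norm ?ler0n// in gK.
  move=> x x'; apply: le_trans (gK x x'); rewrite /f.
  move: (k.+1%:R * D x) (k.+1%:R * D x') => u v.
  have [u1|u1] := ltP 1 u; have [v1|v1] := ltP 1 v; rewrite ?subrr ?normr0//.
  - by rewrite !ger0_norm; lra.
  - by rewrite !ler0_norm; lra.
have bf := bounded_measurable_lipK fK.
have Ff x : \1_(F k) x <= f x.
  rewrite indicE /f; have [|] := boolP (x \in F k).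
    rewrite inE /= => kx; rewrite le_min lexx/=.
    by rewrite -ler_pdivrMl ?ltr0n// mulr1.
  by rewrite le_min ler01 mulr_ge0.
have fU x : f x <= \1_U x.
  rewrite indicE /f; have [|] := boolP (x \in U); first by rewrite ge_min lexx.
  by rewrite notin_setE => /DU ->; rewrite mulr0 ge_min lexx orbT.
have mU := open_measurable_circle oU.
rewrite -!mean_indic// lee_fin (@le_trans _ _ (J mu f))//.
  by apply: mean_le => //; exact: bounded_measurable_indic.
rewrite munu; last exact: lipK_continuous fK.
by apply: mean_le => //; exact: bounded_measurable_indic.
Qed.

Lemma probability_eq_of_means mu nu : (forall f, continuous f -> J mu f = J nu f) ->
  forall B, measurable B -> mu B = nu B.
Proof.
move=> munu; apply: (measure_unique (@open (circle R)) (fun=> setT)) => //.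
- by move=> U V; exact: openI.
- by move=> _; exact: openT.
- exact: bigcup_const.
- move=> U oU; apply/eqP; rewrite eq_le !open_le_of_means// => f cf.
  by rewrite munu.
- by move=> _; rewrite [X in (X < _)%E]probability_setT ltry.
Qed.

Variable d : nat.
Local Notation T := (@expanding_map R d).

Lemma weak_limit_mean (mu_ : (probability (circle R) R)^nat) nu f :
  weakly_converges mu_ nu -> continuous f -> J (mu_ n) f @[n --> \oo] --> J nu f.
Proof.
move=> w cf; have bf := bounded_measurable_continuous cf.
by apply: fine_cvg; rewrite -meanE//; exact: w.
Qed.

(** The image of [nu] under [T] and [nu] give the same mean to every continuous function, hence
    coincide on Borel sets. *)
Lemma weak_limit_invariant (mu_ : (probability (circle R) R)^nat) nu :
  (forall n, invariant_probability d (mu_ n)) -> weakly_converges mu_ nu ->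
  invariant_probability d nu.
Proof.
move=> imu w B mB; apply: (@probability_eq_of_means (distribution nu T) nu) => // f cf.
have bf := bounded_measurable_continuous cf.
have mf : measurable_fun setT (EFin \o f) by apply/measurable_EFinP; exact: bf.1.
have bfT := bounded_measurable_integrable nu (bounded_measurable_comp d bf).
have -> : J (distribution nu T) f = J nu (f \o T).
  by rewrite /Rintegral (@integral_distribution _ _ _ _ _ nu T (EFin \o f) mf bfT).
have cfT : continuous (f \o T).
  by move=> x; apply: continuous_comp; [exact: expanding_map_continuous|exact: cf].
have E : (fun n => J (mu_ n) (f \o T)) = (fun n => J (mu_ n) f).
  by apply/funext => n; rewrite mean_comp.
have := weak_limit_mean w cfT; rewrite E => lim.
rewrite -(cvg_lim (@Rhausdorff R) lim).
by rewrite -(cvg_lim (@Rhausdorff R) (weak_limit_mean w cf)).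
Qed.

Hypothesis d2 : (2 <= d)%N.

(** For an invariant measure the normalized potential has mean [J mu A - (1 - lam) * J mu b]. As [b]
    differs from [b 0] by at most [K] for every [lam], [mu_ n] maximizes the mean of [A] up to
    [(1 - lam_ n) * (K + K)], which tends to 0. *)
Lemma weak_limit_maximizing A (lam_ : R^nat) (mu_ : (probability (circle R) R)^nat) nu :
  circle_lipschitz A -> (forall n, 0 < lam_ n < 1) -> lam_ n @[n --> \oo] --> (1 : R) ->
  (forall n, lambda_maximizing d (lam_ n) A (mu_ n)) -> weakly_converges mu_ nu ->
  maximizing d A nu.
Proof.
move=> [K AK] lam01 lam1 mumax w; have K0 := lipK_ge0 (AK : lipK K A).
have bA := bounded_measurable_lipK (AK : lipK K A).
have lmax n : exists2 b, calibrated_subaction d (lam_ n) A b &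
    maximizing d (fun x => A x - b (T x) + lam_ n * b x) (mu_ n).
  have := mumax n; rewrite /lambda_maximizing lt_eqF//.
  by have /andP[] := lam01 n.
have imu n : invariant_probability d (mu_ n) by have [b _ []] := lmax n.
have inu := weak_limit_invariant imu w.
apply/maximizingP => //; split=> // rho irho.
have key n : J rho A <= J (mu_ n) A + (1 - lam_ n) * (K + K).
  have [b bE bmax] := lmax n; have /andP[l0 l1] := lam01 n.
  have bK : lipK K b by apply: (calibrated_lipK d2 _ AK bE); rewrite (ltW l0) l1.
  have bb := bounded_measurable_lipK bK; have bbT := bounded_measurable_comp d bb.
  pose f x := A x - b (T x) + lam_ n * b x.
  have fE mu : invariant_probability d mu -> J mu f = J mu A - (1 - lam_ n) * J mu b.
    move=> imu'; have b1 := bounded_measurableZ (- 1) bbT.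
    have b2 := bounded_measurableZ (lam_ n) bb.
    transitivity (J mu ((A \+ (fun x => -1 * (b \o T) x)) \+ (fun x => lam_ n * b x))).
      by apply: eq_Rintegral => x _; rewrite /f /= mulN1r.
    rewrite meanD//; last exact: bounded_measurableD.
    by rewrite meanD// !meanZ// mean_comp//; ring.
  have bf : bounded_measurable f.
    rewrite (_ : f = (A \- (b \o T)) \+ (fun x => lam_ n * b x))//.
    exact: bounded_measurable_lipK (lipKD (lipKB AK (lipK_comp_map d bK)) (lipKZ (lam_ n) bK)).
  have /(maximizingP d _ bf)[_ /(_ rho irho)] := bmax.
  rewrite !fE// => h.
  have Jrho : J rho b <= b 0 + K.
    rewrite -(mean_cst rho (b 0 + K)); apply: mean_le => //; first exact: bounded_measurable_cst.
    by move=> x; have := le_trans (ler_norm _) (lipK_ub x 0 bK); lra.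
  have Jmu : b 0 - K <= J (mu_ n) b.
    rewrite -(mean_cst (mu_ n) (b 0 - K)); apply: mean_le => //.
      exact: bounded_measurable_cst.
    by move=> x; have := le_trans (ler_norm _) (lipK_ub 0 x bK); lra.
  have : (1 - lam_ n) * (J rho b - J (mu_ n) b) <= (1 - lam_ n) * (K + K).
    by rewrite ler_wpM2l//; lra.
  lra.
have lim : J (mu_ n) A + (1 - lam_ n) * (K + K) @[n --> \oo] --> J nu A.
  rewrite -[X in _ --> X]addr0; apply: cvgD.
    exact: weak_limit_mean w (lipK_continuous AK).
  rewrite -(mul0r (K + K)) -(subrr 1); apply: cvgMl; apply: cvgB => //.
  exact: cvg_cst.
by apply: (cvgr_to_ge lim); exact: nearW.
Qed.

End weak_limits.

Theorem theorem1 (R : realType) (d : nat) (hd : (2 <= d)%N) :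
  (forall (A : circle R -> R) (lam_ : R^nat)
      (mu_ : (probability (circle R) R)^nat) (nu : probability (circle R) R),
    circle_lipschitz A ->
    (forall n, 0 < lam_ n < 1) ->
    lam_ n @[n --> \oo] --> (1 : R) ->
    (forall n, lambda_maximizing d (lam_ n) A (mu_ n)) ->
    weakly_converges mu_ nu ->
    maximizing d A nu) /\
  generic [set A : lip_potential R | selects_periodic_orbit d A] /\
  generic [set A : C1_potential R | selects_periodic_orbit d A].
Proof.
split; last by split; [exact: generic_lip_potential|exact: generic_C1_potential].
by move=> A lam_ mu_ nu; exact: weak_limit_maximizing.
Qed.
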